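(* Let $n \ge 3$ and let $K$ be a smooth real-valued function on $\mathbb{R}^n$. Assume that $K$ is bounded between two positive numbers outside a compact subset of $\mathbb{R}^n$. Let $u$ be a positive smooth solution of $$\Delta u + K u^{\frac{n+2}{n-2}} = 0 \quad \text{in } \mathbb{R}^n .$$ Assume that $$\lim_{r\to\infty} \int_{S_r} r\left[\frac{\partial u}{\partial r} + \frac{n-2}{2}\,\frac{u}{r}\right]^2 dS = 0 .$$ If the Pohozaev number $P(u)$ exists, then $P(u) \le 0$. Furthermore, $P(u) = 0$ implies that $$\liminf_{|x|\to\infty} |x|^{(n-2)/2}\, u(x) = 0 .$$
   Context: $\Delta$ is the standard Laplacian on $\mathbb{R}^n$; $B_o(r)$ is the open ball of radius $r$ centered at the origin, $S_r = \partial B_o(r)$ is the sphere of radius $r$ with surface measure $dS$, and $\partial/\partial r$ is the radial derivative. For $r>0$ put $$P(u,r) = \frac{n-2}{2n}\int_{B_o(r)} x\cdot\nabla K(x)\, u^{\frac{2n}{n-2}}(x)\,dx .$$ The Pohozaev number of $u$ is $P(u) = \lim_{r\to\infty} P(u,r)$, provided the limit exists. *)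

(* Defs.v *)
From HB Require Import structures.
From mathcomp Require Import all_boot all_order all_algebra.
From mathcomp Require Import all_classical all_reals all_analysis.
From mathcomp Require Import measurable_realfun.

Set Implicit Arguments.
Unset Strict Implicit.
Unset Printing Implicit Defensive.

Import Order.TTheory GRing.Theory Num.Theory.
Import numFieldNormedType.Exports.

Local Open Scope classical_set_scope.
Local Open Scope ring_scope.

(* The norm that the library puts on 'rV[R]_n is the sup norm; it is used only
   through the topology it induces (continuity, compactness, derivatives). *)
Definition enorm {R : realType} {n : nat} (x : 'rV[R]_n) : R :=
  Num.sqrt (\sum_(i < n) x 0 i ^+ 2).

Definition eball (R : realType) (n : nat) (r : R) : set 'rV[R]_n :=
  [set x | enorm x < r].
Arguments eball {R} n r.

Definition esphere (R : realType) (n : nat) (r : R) : set 'rV[R]_n :=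
  [set x | enorm x = r].
Arguments esphere {R} n r.

(* The filter "|x| -> +oo" on R^n. *)
Definition enorm_pinfty (R : realType) (n : nat) : set_system 'rV[R]_n :=
  [set A | \forall r \near +oo, forall x : 'rV[R]_n, r < enorm x -> A x].
Arguments enorm_pinfty R n : clear implicits.

Global Instance enorm_pinfty_filter (R : realType) (n : nat) :
  Filter (enorm_pinfty R n).
Proof.
pose B (A : set 'rV[R]_n) : set R := [set r | forall x, r < enorm x -> A x].
have BE A : enorm_pinfty R n A = (+oo_R)%R (B A) by [].
split; rewrite ?BE; first exact: filterS filterT.
- move=> P Q; rewrite !BE => hP hQ; apply: filterS2 hP hQ => r rP rQ x rx.
  by split; [exact: rP|exact: rQ].
- by move=> P Q PQ; rewrite !BE; apply: filterS => r rP x /rP /PQ.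
Qed.

Section differential_operators.
Context {R : realType} {n : nat}.
Implicit Types (f u K : 'rV[R]_n -> R) (x : 'rV[R]_n) (i : 'I_n).

Definition partial f i : 'rV[R]_n -> R := 'D_(delta_mx 0 i) f.

Definition iter_partial f (s : seq 'I_n) : 'rV[R]_n -> R := foldl partial f s.

(* C^oo: partial derivatives of all orders exist and are continuous. *)
Definition smooth f : Prop :=
  forall s : seq 'I_n, continuous (iter_partial f s) /\
    forall i x, derivable (iter_partial f s) x (delta_mx 0 i).

Definition laplacian f x : R := \sum_(i < n) partial (partial f i) i x.

Definition dot_grad f x : R := \sum_(i < n) x 0 i * partial f i x.

(* Meaningless at the origin, where the direction degenerates to 0. *)
Definition radial_derivative f x : R := 'D_((enorm x)^-1 *: x) f x.

End differential_operators.

Section measurable_rV.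
Context {R : realType} {n : nat}.

Let coord : 'I_n -> 'rV[R]_n -> measurableTypeR R := fun i x => x 0 i.

Let rV_set0 : g_sigma_preimage coord set0.
Proof. exact: sigma_algebra0. Qed.

Let rV_setC A : g_sigma_preimage coord A -> g_sigma_preimage coord (~` A).
Proof. exact: sigma_algebraC. Qed.

Let rV_bigcup (F : _^nat) : (forall i, g_sigma_preimage coord (F i)) ->
  g_sigma_preimage coord (\bigcup_i (F i)).
Proof. exact: sigma_algebra_bigcup. Qed.

(* The product (= Borel) sigma-algebra of R^n. *)
HB.instance Definition _ := @isMeasurable.Build default_measure_display
  'rV[R]_n (g_sigma_preimage coord) rV_set0 rV_setC rV_bigcup.

Lemma measurable_coord (i : 'I_n) :
  measurable_fun [set: 'rV[R]_n] (fun x : 'rV[R]_n => x 0 i : measurableTypeR R).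
Proof.
move=> _ Y mY; rewrite setTI; apply: sub_sigma_algebra => /=.
rewrite -bigcup_seq/=; exists i => /=; first by rewrite mem_index_enum.
by exists Y => //; rewrite setTI.
Qed.

Lemma measurable_fun_rV d (T : measurableType d) (f : T -> 'rV[R]_n) :
  (forall i, measurable_fun [set: T] (fun t => f t 0 i : measurableTypeR R)) ->
  measurable_fun [set: T] f.
Proof.
move=> mf _ A mA; rewrite setTI.
suff : g_sigma_preimage coord `<=` [set B | measurable (f @^-1` B)] by exact.
apply: smallest_sub.
- split.
  + by rewrite /= preimage_set0; exact: measurable0.
  + by move=> B /= mB; rewrite setTD preimage_setC; exact: measurableC.
  + by move=> F mF /=; rewrite preimage_bigcup; exact: bigcupT_measurable.
- move=> B; rewrite -bigcup_seq => -[i _] [C mC <-] /=.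
  by rewrite setTI -[X in measurable X]setTI; exact: mf.
Qed.

End measurable_rV.

Section lebesgue_rV.
Context {R : realType}.

Definition cons_rV n (p : measurableTypeR R * 'rV[R]_n) : 'rV[R]_n.+1 :=
  row_mx (p.1%:M : 'M[R]_1) p.2.

Lemma cons_rV0 n p : @cons_rV n p 0 0 = p.1.
Proof.
have -> : (0 : 'I_n.+1) = @lshift 1 n 0 by exact: val_inj.
by rewrite /cons_rV (@row_mxEl R 1 1 n) mxE eqxx.
Qed.

Lemma cons_rVS n p i : @cons_rV n p 0 (lift ord0 i) = p.2 0 i.
Proof.
have -> : lift ord0 i = @rshift 1 n i by exact: val_inj.
by rewrite /cons_rV (@row_mxEr R 1 1 n).
Qed.

Let uncons_rV n (x : 'rV[R]_n.+1) : measurableTypeR R * 'rV[R]_n :=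
  (x 0 0, @rsubmx R 1 1 n x).

Let cons_rVK n : cancel (@cons_rV n) (@uncons_rV n).
Proof.
by case=> t x; rewrite /uncons_rV cons_rV0 /cons_rV /= row_mxKr.
Qed.

Let uncons_rVK n : cancel (@uncons_rV n) (@cons_rV n).
Proof.
move=> x; rewrite /uncons_rV /cons_rV /= -[RHS](@hsubmxK R 1 1 n).
congr (@row_mx R 1 1 n _ _); apply/rowP => i; rewrite !ord1 !mxE eqxx mulr1n.
by congr (x _ _); exact: val_inj.
Qed.

Lemma measurable_cons_rV n : measurable_fun setT (@cons_rV n).
Proof.
apply: measurable_fun_rV => i; have [->|] := eqVneq i 0.
  by under eq_fun do rewrite cons_rV0; exact: measurable_fst.
rewrite eq_sym => /unlift_some[j -> _]; under eq_fun do rewrite cons_rVS.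
exact: (measurableT_comp (measurable_coord j) measurable_snd).
Qed.

Let measurable_uncons_rV n : measurable_fun setT (@uncons_rV n).
Proof.
apply: measurable_fun_pair; first exact: measurable_coord.
apply: measurable_fun_rV => i; under eq_fun do rewrite mxE.
exact: measurable_coord.
Qed.

Definition lebesgue_cons n (mu : {sigma_finite_measure set 'rV[R]_n -> \bar R}) :
    set 'rV[R]_n.+1 -> \bar R :=
  pushforward (lebesgue_measure \x mu)%E (@cons_rV n).

Section instances.
Variables (n : nat) (mu : {sigma_finite_measure set 'rV[R]_n -> \bar R}).

Let lebesgue_cons0 : lebesgue_cons mu set0 = 0%E.
Proof. have mc := @measurable_cons_rV n; exact: measure0. Qed.

Let lebesgue_cons_ge0 A : (0 <= lebesgue_cons mu A)%E.
Proof. have mc := @measurable_cons_rV n; exact: measure_ge0. Qed.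

Let lebesgue_cons_sigma_additive : semi_sigma_additive (lebesgue_cons mu).
Proof.
have mc := @measurable_cons_rV n; exact: measure_semi_sigma_additive.
Qed.

HB.instance Definition _ := isMeasure.Build _ _ _ (lebesgue_cons mu)
  lebesgue_cons0 lebesgue_cons_ge0 lebesgue_cons_sigma_additive.

Let lebesgue_cons_sigma_finite : sigma_finite setT (lebesgue_cons mu).
Proof.
have /sigma_finiteP[F [TF ndF Foo]] := sigma_finiteT (@lebesgue_measure R).
have /sigma_finiteP[G [TG ndG Goo]] := sigma_finiteT mu.
exists (fun k => @uncons_rV n @^-1` (F k `*` G k)).
  rewrite -preimage_bigcup (_ : \bigcup_k _ = setT) ?preimage_setT//.
  rewrite -subTset => -[t x] _.
  have [a _ Fat] : (\bigcup_k F k) t by rewrite -TF.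
  have [b _ Gbx] : (\bigcup_k G k) x by rewrite -TG.
  exists (maxn a b) => //; split => /=.
    by move: t Fat; exact/subsetPset/ndF/leq_maxl.
  by move: x Gbx; exact/subsetPset/ndG/leq_maxr.
move=> k; have [mF Fk] := Foo k; have [mG Gk] := Goo k; split.
  rewrite -[X in measurable X]setTI; apply: measurable_uncons_rV => //.
  exact: measurableX.
rewrite /lebesgue_cons /pushforward -comp_preimage.
rewrite (_ : _ \o _ = id); last by apply/funext => p /=; rewrite cons_rVK.
by rewrite preimage_id product_measure1E// lte_mul_pinfty// ge0_fin_numE.
Qed.

HB.instance Definition _ := Measure_isSigmaFinite.Build _ _ _
  (lebesgue_cons mu) lebesgue_cons_sigma_finite.

End instances.

Fixpoint lebesgue_rV n : {sigma_finite_measure set 'rV[R]_n -> \bar R} :=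
  match n with
  | 0 => \d_(0 : 'rV[R]_0)
  | n.+1 => lebesgue_cons (lebesgue_rV n)
  end.

Lemma measurable_box n (A : 'I_n -> set (measurableTypeR R)) :
  (forall i, measurable (A i)) ->
  measurable [set x : 'rV[R]_n | forall i, A i (x 0 i)].
Proof.
move=> mA; rewrite (_ : mkset _ =
    \big[setI/setT]_(i < n) [set x : 'rV[R]_n | A i (x 0 i)]).
  apply: bigsetI_measurable => i _; rewrite -[X in measurable X]setTI.
  exact: (measurable_coord i) (mA i).
rewrite -bigcap_seq; apply/seteqP; split => x /= Ax i; first by move=> _.
by apply: Ax; rewrite /= mem_index_enum.
Qed.

Lemma lebesgue_rV_box n (A : 'I_n -> set (measurableTypeR R)) :
  (forall i, measurable (A i)) ->
  lebesgue_rV n [set x | forall i, A i (x 0 i)] =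
  (\prod_(i < n) lebesgue_measure (A i))%E.
Proof.
elim: n A => [|n IH] A mA.
  by rewrite big_ord0 /= diracE mem_set// => -[].
rewrite big_ord_recl -IH// -product_measure1E//; last first.
  exact: (@measurable_box n (fun i => A (lift ord0 i))).
rewrite /= /lebesgue_cons /pushforward; congr product_measure1.
apply/seteqP; split => -[t x] /=.
- move=> Atx; split => [|i]; first by have := Atx 0; rewrite cons_rV0.
  by have := Atx (lift ord0 i); rewrite cons_rVS.
- move=> [At Ax] i; have [->|] := eqVneq i 0; first by rewrite cons_rV0.
  by rewrite eq_sym => /unlift_some[j -> _]; rewrite cons_rVS; exact: Ax.
Qed.

End lebesgue_rV.
Arguments lebesgue_rV {R} n.

Section surface_measure.
Context {R : realType} {n : nat}.
Implicit Types (r : R) (x : 'rV[R]_n).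

Definition sphere_proj r x : 'rV[R]_n := (r / enorm x) *: x.

Definition punctured_ball r : set 'rV[R]_n := [set x | 0 < enorm x <= r].

Lemma enorm_ge0 x : 0 <= enorm x.
Proof. exact: sqrtr_ge0. Qed.

Lemma enormZ (a : R) x : enorm (a *: x) = `|a| * enorm x.
Proof.
rewrite /enorm; under eq_bigr do rewrite mxE exprMn.
by rewrite -mulr_sumr sqrtrM ?sqr_ge0// sqrtr_sqr.
Qed.

Lemma measurable_enorm : measurable_fun setT (@enorm R n).
Proof.
under [X in measurable_fun _ X]funext => x.
  rewrite /enorm -powR12_sqrt; last by apply: sumr_ge0 => i _; exact: sqr_ge0.
  over.
apply: (measurableT_comp (measurable_powR 2^-1)).
by apply: measurable_sum => i; apply: measurable_funX; exact: measurable_coord.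
Qed.

Lemma measurable_sphere_proj r : measurable_fun setT (sphere_proj r).
Proof.
apply: measurable_fun_rV => i.
under eq_fun do rewrite mxE -powR_inv1 ?enorm_ge0//.
apply: measurable_funM; last exact: measurable_coord.
apply: measurable_funM => //.
exact: (measurableT_comp (measurable_powR (-1)) measurable_enorm).
Qed.

Lemma measurable_punctured_ball r : measurable (punctured_ball r).
Proof.
rewrite (_ : punctured_ball r = setT `&` enorm @^-1` `]0, r]).
  by apply: measurable_enorm => //; exact: measurable_itv.
by rewrite setTI; apply/seteqP; split => x; rewrite /punctured_ball /= in_itv.
Qed.

Definition sphere_pushforward r : set 'rV[R]_n -> \bar R :=
  pushforward (mrestr (lebesgue_rV n) (measurable_punctured_ball r))
              (sphere_proj r).

Section instances.
Variable r : R.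

Let sphere_pushforward0 : sphere_pushforward r set0 = 0%E.
Proof. have mp := measurable_sphere_proj r; exact: measure0. Qed.

Let sphere_pushforward_ge0 A : (0 <= sphere_pushforward r A)%E.
Proof. have mp := measurable_sphere_proj r; exact: measure_ge0. Qed.

Let sphere_pushforward_sigma_additive :
  semi_sigma_additive (sphere_pushforward r).
Proof.
have mp := measurable_sphere_proj r; exact: measure_semi_sigma_additive.
Qed.

HB.instance Definition _ := isMeasure.Build _ _ _ (sphere_pushforward r)
  sphere_pushforward0 sphere_pushforward_ge0 sphere_pushforward_sigma_additive.

End instances.

(* The surface measure dS of the sphere of radius r, as the cone measure:
   see surface_measureE. It is only meaningful for r > 0. *)
Definition surface_measure r : {measure set 'rV[R]_n -> \bar R} :=
  mscale (n%:R / `|r|)%:nng (sphere_pushforward r).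

Lemma surface_measureE r (A : set 'rV[R]_n) : 0 < r ->
  surface_measure r A = ((n%:R / r)%:E *
    lebesgue_rV n [set t *: y | t in `]0%R, 1%R] & y in A `&` esphere n r])%E.
Proof.
move=> r0; rewrite /surface_measure /= /mscale /= gtr0_norm//; congr (_ * _)%E.
rewrite /sphere_pushforward /pushforward /mrestr; congr (lebesgue_rV n _).
apply/seteqP; split => x /=.
- move=> [Ax /andP[x0 xr]].
  exists (enorm x / r).
    by rewrite /= in_itv/= divr_gt0//= ler_pdivrMr// mul1r.
  exists (sphere_proj r x).
    split => //; rewrite /esphere /= enormZ ger0_norm ?divr_ge0 ?ltW//.
    by rewrite divfK ?gt_eqF.
  rewrite /sphere_proj scalerA mulrA divfK ?gt_eqF//.
  by rewrite divff ?gt_eqF// scale1r.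
- move=> [t]; rewrite /= in_itv/= => /andP[t0 t1] [y [Ay yr] <-].
  have ty : enorm (t *: y) = t * r by rewrite enormZ yr gtr0_norm.
  rewrite /punctured_ball /= /sphere_proj ty; split; last first.
    by rewrite mulr_gt0//= ler_piMl// ltW.
  by rewrite scalerA invfM mulrCA mulfV ?gt_eqF// mulr1 mulVf ?gt_eqF// scale1r.
Qed.

End surface_measure.
Arguments surface_measure {R} n r.

(* Real-valued integrals: the integrands of interest are continuous on a
   bounded ball, respectively on a sphere, so both are genuine integrals. *)
Definition pohozaev {R : realType} {n : nat} (K u : 'rV[R]_n -> R) (r : R) : R :=
  (n%:R - 2) / (2 * n%:R) *
  \int[lebesgue_rV n]_(x in eball n r)
    (dot_grad K x * u x `^ (2 * n%:R / (n%:R - 2))).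

Definition pohozaev_number {R : realType} {n : nat} (K u : 'rV[R]_n -> R) : R :=
  lim (pohozaev K u r @[r --> +oo]).

(* Main.v *)
(* In the variable t = ln r, let m be the integral over the sphere of radius r of
   u ^ 2 / r, which is the integral over the unit sphere of v ^ 2, where
   v = r ^ ((n - 2) / 2) u. The divergence theorem applied to u ^ 2 x and u grad u
   computes m' and m'', and Pohozaev's identity then gives
     m'' = - 4 P(u, r) + 4 H(r) - (4 / n) r \int_{S_r} K u ^ (2n / (n - 2)) dS,
   where H is the quantity assumed to tend to 0. If P(u) > 0, or if P(u) = 0 and
   v is bounded below by a positive constant, the right-hand side is eventually
   below a negative constant, so that m is eventually negative, which is absurd. *)
From HB Require Import structures.
Require Import Defs.
From mathcomp Require Import all_boot all_order all_algebra.
From mathcomp Require Import all_classical all_reals all_analysis.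
From mathcomp Require Import measurable_realfun ring lra.

Set Implicit Arguments.
Unset Strict Implicit.
Unset Printing Implicit Defensive.

Import Order.TTheory GRing.Theory Num.Theory.
Import numFieldNormedType.Exports.

Local Open Scope classical_set_scope.
Local Open Scope ring_scope.

(** * Continuous functions and balls of the Euclidean space *)

(** Everything is reduced to integrals over balls. The surface measure is a multiple of the image of
    Lebesgue measure under radial projection, so a sphere integral is a ball integral of a function
    homogeneous of degree 0, and it is also the derivative of a ball integral with respect to the
    radius. No parametrization of the sphere occurs, and the divergence theorem comes down to
    components that vanish on the sphere, for which Fubini and the fundamental theorem of calculus
    suffice.

    The obstacle is that a sphere integral has no evident derivative in [r]. Hence [m] is written as
    [r^-2] times the ball integral of div(u ^ 2 x), and its logarithmic derivative as a combination
    of [m] and the ball integral of div(u grad u), so that each differentiation falls on a ball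
    integral. The second derivative then contains the sphere integral of |grad u| ^ 2, which no
    hypothesis controls. Pohozaev's identity eliminates it, and the remaining terms in u and x.grad
    u form the perfect square of H.

    Smoothness speaks of iterated partial derivatives only, so the symmetry of second derivatives
    and the gradient formula for the radial derivative are obtained from the mean value theorem
    along lines. *)

Section continuous_realfun.
Context {R : realType} {T : topologicalType}.
Implicit Types f g : T -> R.

Lemma continuous_add f g :
  continuous f -> continuous g -> continuous (fun x => f x + g x).
Proof. by move=> cf cg x; apply: cvgD; [exact: cf|exact: cg]. Qed.

Lemma continuous_sub f g :
  continuous f -> continuous g -> continuous (fun x => f x - g x).
Proof. by move=> cf cg x; apply: cvgB; [exact: cf|exact: cg]. Qed.

Lemma continuous_mul f g :
  continuous f -> continuous g -> continuous (fun x => f x * g x).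
Proof. by move=> cf cg x; apply: cvgM; [exact: cf|exact: cg]. Qed.

Lemma continuous_expn f k : continuous f -> continuous (fun x => f x ^+ k).
Proof.
move=> cf x; apply: (@continuous_comp _ _ _ f (fun y => y ^+ k)); first exact: cf.
exact: exprn_continuous.
Qed.

Lemma continuous_sum m (F : 'I_m -> T -> R) :
  (forall i, continuous (F i)) -> continuous (fun x => \sum_(i < m) F i x).
Proof.
elim: m F => [|m IH] F cF.
  rewrite (_ : (fun _ => _) = cst 0); first exact: cst_continuous.
  by apply/funext => x; rewrite big_ord0.
rewrite (_ : (fun _ => _) = fun x => F ord0 x + \sum_(i < m) F (lift ord0 i) x).
  by apply: continuous_add => //; exact: IH.
by apply/funext => x; rewrite big_ord_recl.
Qed.

End continuous_realfun.

Section euclidean_topology.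
Context {R : realType} {n : nat}.
Implicit Types (f : 'rV[R]_n -> R) (x : 'rV[R]_n).

(** The sigma-algebra is generated by the coordinates, so an open set is exhausted by countably many
    boxes: those inside it with rational centre and half-side [1 / (k + 1)]. Two points of such a
    box are at sup distance less than [2 / (k + 1)], hence the choice of [k] below. *)
Lemma open_measurable_rV (A : set 'rV[R]_n) : open A -> measurable A.
Proof.
move=> oA.
pose box (p : 'rV[rat]_n * nat) := [set x : 'rV[R]_n | forall i,
  `](ratr (p.1 0 i) - p.2.+1%:R^-1), (ratr (p.1 0 i) + p.2.+1%:R^-1)[%classic (x 0 i)].
have -> : A = \bigcup_(p in [set p | box p `<=` A]) box p.
  apply/seteqP; split; last by move=> x [p /= pA]; exact: pA.
  move=> x Ax.
  have /nbhs_ballP[e e0 xeA] : nbhs x A by apply: open_nbhs_nbhs; split.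
  have [k ke] : exists k, 2 * k.+1%:R^-1 < e.
    have [k _ /(_ k (leqnn k)) /= kE] := near_infty_natSinv_lt (PosNum (divr_gt0 e0 (ltr0Sn R 1))).
    by exists k; rewrite mulrC -ltr_pdivlMr.
  have qx j : exists q : rat, x 0 j - k.+1%:R^-1 < ratr q < x 0 j + k.+1%:R^-1.
    have [|q] := @rat_in_itvoo R (x 0 j - k.+1%:R^-1) (x 0 j + k.+1%:R^-1).
      by rewrite ltrD2l gtrN// invr_gt0.
    by rewrite in_itv; exists q.
  pose q : 'rV[rat]_n := \row_j sval (cid (qx j)).
  have qE j : x 0 j - k.+1%:R^-1 < ratr (q 0 j) < x 0 j + k.+1%:R^-1.
    by rewrite mxE; case: cid.
  exists (q, k) => /= [y yq|j]; last first.
    by rewrite /= in_itv/=; have := qE j; move: k.+1%:R^-1 => a; lra.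
  apply: xeA; split => // i j; rewrite ord1 /ball/= ltr_norml.
  have := yq j; rewrite /= in_itv/=; have := qE j; move: ke.
  by move: k.+1%:R^-1 => a; lra.
rewrite bigcup_mkcond; apply: countable_bigcupT_measurable => [|p].
  exact: countableP.
case: ifPn => // _; apply: (@measurable_box _ _ (fun i => `]_, _[%classic)) => i.
exact: measurable_itv.
Qed.

Lemma continuous_measurable_rV f : continuous f -> measurable_fun [set: 'rV[R]_n] f.
Proof.
move=> cf; apply: (measurability _ (RGenOpens.measurableE R)) => _ [_ [a [b ->]] <-].
rewrite setTI; apply: open_measurable_rV; apply: open_comp => // x _; exact: cf.
Qed.

Lemma continuous_coord i : continuous (fun x : 'rV[R]_n => x 0 i).
Proof. exact: coord_continuous. Qed.

Lemma enorm_sqr x : enorm x ^+ 2 = \sum_(i < n) x 0 i ^+ 2.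
Proof. by rewrite sqr_sqrtr// sumr_ge0// => i _; exact: sqr_ge0. Qed.

Lemma continuous_enorm : continuous (@enorm R n).
Proof.
have c : continuous (fun x : 'rV[R]_n => \sum_(i < n) x 0 i ^+ 2).
  by apply: continuous_sum => i; apply: continuous_expn; exact: continuous_coord.
by move=> x; apply: (continuous_comp (c x)); exact: sqrt_continuous.
Qed.

Lemma enorm_coord_le x i : `|x 0 i| <= enorm x.
Proof.
rewrite -sqrtr_sqr ler_sqrt ?sumr_ge0//; last by move=> *; exact: sqr_ge0.
by rewrite (bigD1 i)//= lerDl sumr_ge0// => *; exact: sqr_ge0.
Qed.

Lemma enorm_eq0 x : (enorm x == 0) = (x == 0).
Proof.
apply/eqP/eqP => [x0|->]; last by rewrite -[0](scale0r 0) enormZ normr0 mul0r.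
by apply/rowP => i; rewrite mxE; apply/eqP; rewrite -normr_le0 -x0 enorm_coord_le.
Qed.

Lemma enorm0 : enorm (0 : 'rV[R]_n) = 0.
Proof. by apply/eqP; rewrite enorm_eq0. Qed.

Lemma compact_cball r : compact [set x : 'rV[R]_n | enorm x <= r].
Proof.
apply: (subclosed_compact _ (rV_compact (fun=> @segment_compact R (- r) r))).
  apply: (@preimage_closed _ _ _ [set t | t <= r]) => [x _|].
    exact: continuous_enorm.
  exact: closed_le.
by move=> x /= xr i; rewrite in_itv/= -ler_norml (le_trans _ xr)// enorm_coord_le.
Qed.

Lemma compact_esphere r : compact (esphere n r : set 'rV[R]_n).
Proof.
apply: (subclosed_compact _ (@compact_cball r)).
  apply: (@preimage_closed _ _ _ [set t | t = r]) => [x _|].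
    exact: continuous_enorm.
  exact: closed_eq.
by move=> x /= ->.
Qed.

Lemma measurable_eball r : measurable (eball n r : set 'rV[R]_n).
Proof.
apply: open_measurable_rV; apply: (@open_comp _ _ _ [set t | t < r]) => [x _|].
  exact: continuous_enorm.
exact: open_lt.
Qed.

Lemma measurable_esphere r : measurable (esphere n r : set 'rV[R]_n).
Proof.
rewrite -[esphere _ _]setTI; exact: (measurable_enorm measurableT (measurable_set1 r)).
Qed.

Lemma lebesgue_eball_lty r : (lebesgue_rV n (eball n r : set 'rV[R]_n) < +oo)%E.
Proof.
apply: (@le_lt_trans _ _ (lebesgue_rV n
    [set x : 'rV[R]_n | forall i, (`[- r, r]%classic : set R) (x 0 i)])).
  apply: le_measure; rewrite ?inE; [exact: measurable_eball|..].
    by apply: (@measurable_box _ _ (fun=> _)) => i; exact: measurable_itv.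
  move=> x /= xr i; rewrite in_itv/= -ler_norml (le_trans (enorm_coord_le x i))//.
  exact: ltW.
rewrite (lebesgue_rV_box (A := fun=> `[- r, r]%classic)) => [|i]; last exact: measurable_itv.
suff : (\prod_(i < n) lebesgue_measure (`[(- r)%R, r]%classic : set R))%E \is a fin_num.
  by rewrite fin_numElt => /andP[].
apply: (@big_ind _ (fun x : \bar R => x \is a fin_num)) => //.
- exact: fin_numM.
- by move=> i _; rewrite lebesgue_measure_itv/=; case: ifPn.
Qed.

Lemma bounded_integrable_eball f r M : measurable_fun [set: 'rV[R]_n] f ->
  (forall x, enorm x < r -> `|f x| <= M) ->
  (lebesgue_rV n).-integrable (eball n r) (EFin \o f).
Proof.
move=> mf fM; apply: measurable_bounded_integrable.
- exact: measurable_eball.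
- exact: lebesgue_eball_lty.
- exact: measurable_funTS.
- by exists M; split; rewrite ?num_real// => t Mt x /fM /le_trans; apply; exact: ltW.
Qed.

Lemma continuous_bounded_cball f r : continuous f ->
  exists M, forall x, enorm x <= r -> `|f x| <= M.
Proof.
move=> cf.
have cf' : {within [set x | enorm x <= r], continuous f}.
  exact: continuous_subspaceT.
have /compact_bounded[M [_ Mf]] := continuous_compact cf' (@compact_cball r).
exists (M + 1) => x xr; apply: (Mf (M + 1)); first by rewrite ltrDl.
by exists x.
Qed.

Lemma continuous_integrable_eball f r : continuous f ->
  (lebesgue_rV n).-integrable (eball n r) (EFin \o f).
Proof.
move=> cf; have [M fM] := continuous_bounded_cball r cf.
apply: (@bounded_integrable_eball _ _ M) => [|x /ltW/fM//].
exact: continuous_measurable_rV.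
Qed.

End euclidean_topology.

(** * Scaling of the Lebesgue measure *)

Section lebesgue_scaling.
Context {R : realType}.
Local Open Scope ereal_scope.

(** By uniqueness of Lebesgue measure: [a] times its image under [t |-> a * t] has the right value
    on half-open intervals. *)
Lemma lebesgue_measure_scale (a : R) (A : set (measurableTypeR R)) : (0 < a)%R ->
  measurable A ->
  lebesgue_measure ((fun t : measurableTypeR R => a * t)%R @^-1` A) = a^-1%:E * lebesgue_measure A.
Proof.
move=> a0 mA.
have ma : measurable_fun [set: measurableTypeR R]
    (fun t : measurableTypeR R => a * t : measurableTypeR R)%R.
  exact: mulrl_measurable.
pose s := (fun t : measurableTypeR R => a * t : measurableTypeR R)%R.
have a0' : (0 <= a)%R by exact: ltW.
have key := @lebesgue_measure_unique R
  (mscale (NngNum a0') (pushforward lebesgue_measure s)).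
rewrite [X in _ = _ * X]key//; last first.
  move=> _ [[x y] _ <-].
  rewrite [RHS]/(a%:E * lebesgue_measure
    ((fun t => a * t)%R @^-1` `]x, y]%classic)).
  have -> : ((fun t : R => a * t)%R @^-1` `]x, y] = `](x / a)%R, (y / a)%R])%classic.
    by apply/seteqP; split => t /=; rewrite !in_itv/= ltr_pdivrMr// ler_pdivlMr// (mulrC t).
  have L (z w : R) : lebesgue_measure `]z, w]%classic = (if z < w then w - z else 0)%R%:E.
    by rewrite lebesgue_measure_itv/= lte_fin; case: ifPn.
  rewrite !L -[(x, y).1]/x -[(x, y).2]/y ltr_pM2r ?invr_gt0//; congr (_%:E).
  by case: ifPn => _; [field; rewrite gt_eqF|rewrite mulr0].
by rewrite /mscale /pushforward/= muleA -EFinM mulVf ?gt_eqF// mul1e.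
Qed.

Lemma measurable_scale_rV n (a : R) :
  measurable_fun setT (fun x : 'rV[R]_n => a *: x)%R.
Proof.
apply: measurable_fun_rV => i; under eq_fun do rewrite mxE.
apply: measurable_funM => //; exact: measurable_coord.
Qed.

Lemma cons_rV_scale n (a t : R) (y : 'rV[R]_n) :
  (a *: cons_rV (t, y) = cons_rV (a * t, a *: y))%R.
Proof.
apply/rowP => i; rewrite mxE; have [->|] := eqVneq i 0%R; first by rewrite !cons_rV0.
by rewrite eq_sym => /unlift_some[j -> _]; rewrite !cons_rVS mxE.
Qed.

(** Induction on the dimension: the sections of [A] contribute [a ^- n] by the induction hypothesis,
    and the change of variable in the first coordinate contributes the last factor [a^-1]. *)
Lemma lebesgue_rV_scale n (a : R) (A : set 'rV[R]_n) : (0 < a)%R -> measurable A ->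
  lebesgue_rV n ((fun x => a *: x)%R @^-1` A) = (a ^- n)%:E * lebesgue_rV n A.
Proof.
move=> a0; elim: n A => [|n IH] A mA.
  rewrite expr0 invr1 mul1e /=; congr (\d_ _ _).
  by apply/seteqP; split => x /=; rewrite [X in A X]thinmx0 [X in _ -> A X]thinmx0.
have mcA : measurable (@cons_rV R n @^-1` A).
  by rewrite -[X in measurable X]setTI; exact: measurable_cons_rV.
have mx : measurable_fun [set: measurableTypeR R]
    (lebesgue_rV n \o xsection (@cons_rV R n @^-1` A)).
  exact: measurable_fun_xsection.
have ma : measurable_fun [set: measurableTypeR R]
    (fun t : measurableTypeR R => a * t : measurableTypeR R)%R.
  exact: mulrl_measurable.
pose s := (fun t : measurableTypeR R => a * t : measurableTypeR R)%R.
have ai0 : (0 <= a^-1)%R by rewrite invr_ge0 ltW.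
rewrite /= /lebesgue_cons /pushforward /product_measure1.
transitivity (\int[lebesgue_measure]_t ((a ^- n)%:E *
    (lebesgue_rV n \o xsection (@cons_rV R n @^-1` A)) (s t))).
  apply: eq_integral => t _ /=; rewrite -IH; last first.
    exact: measurable_xsection.
  congr (lebesgue_rV n _); apply/seteqP; split => y /=; rewrite /xsection/= !inE/=.
    by rewrite cons_rV_scale.
  by rewrite cons_rV_scale.
rewrite ge0_integralZl//; last 2 first.
- by apply: measurableT_comp mx _; exact: ma.
- by rewrite lee_fin invr_ge0 exprn_ge0// ltW.
rewrite exprSr invfM EFinM -muleA; congr (_ * _).
rewrite -(@ge0_integral_pushforward _ _ _ _ _ s ma lebesgue_measure setT
  (lebesgue_rV n \o xsection (@cons_rV R n @^-1` A)))//.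
rewrite (eq_measure_integral (mscale (NngNum ai0) lebesgue_measure)); last first.
  by move=> B mB _; exact: lebesgue_measure_scale.
by rewrite ge0_integral_mscale.
Qed.

End lebesgue_scaling.

(** * Integrals against scaled and restricted measures *)

Section Rintegral_measures.
Context d (T : measurableType d) (R : realType) (m : {measure set T -> \bar R}).

Lemma integrable_mscale (k : {nonneg R}) (D : set T) (f : T -> R) : measurable D ->
  m.-integrable D (EFin \o f) -> (mscale k m).-integrable D (EFin \o f).
Proof.
move=> mD /integrableP[mf foo]; apply/integrableP; split => //.
rewrite ge0_integral_mscale//; last exact: measurableT_comp.
by rewrite lte_mul_pinfty// lee_fin.
Qed.

Lemma Rintegral_mscale (k : {nonneg R}) (D : set T) (f : T -> R) : measurable D ->
  m.-integrable D (EFin \o f) ->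
  \int[mscale k m]_(x in D) f x = k%:num * \int[m]_(x in D) f x.
Proof.
move=> mD fi; have mf := measurable_int m fi.
have mp := measurable_funepos mf; have mn := measurable_funeneg mf.
rewrite /Rintegral integralE [in RHS]integralE !ge0_integral_mscale//.
have fp : (\int[m]_(x in D) (fun x => (f x)%:E)^\+ x)%E \is a fin_num.
  by apply: integrable_fin_num => //; exact: integrable_funepos.
have fn : (\int[m]_(x in D) (fun x => (f x)%:E)^\- x)%E \is a fin_num.
  by apply: integrable_fin_num => //; exact: integrable_funeneg.
by rewrite -(fineK fp) -(fineK fn) /= mulrBr.
Qed.

(** The complement of [D] is null for the restricted measure, so it can be removed from [E]; on what
    is left the two measures coincide. *)
Lemma Rintegral_mrestr (D E : set T) (mD : measurable D) (f : T -> R) :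
  measurable E -> (mrestr m mD).-integrable E (EFin \o f) ->
  \int[mrestr m mD]_(x in E) f x = \int[m]_(x in E `&` D) f x.
Proof.
move=> mE fi; have mDc := measurableC mD.
rewrite /Rintegral (negligible_integral mDc mE fi); last first.
  by rewrite [LHS](_ : _ = m (~` D `&` D))// setICl measure0.
rewrite setDE setCK; congr fine; apply: eq_measure_integral => A mA AED.
by rewrite /= /mrestr; congr (m _); apply/setIidPl => x /AED[].
Qed.

Lemma integrable_mrestr (D E : set T) (mD : measurable D) (f : T -> R) :
  measurable E -> measurable_fun E f -> m.-integrable (E `&` D) (EFin \o f) ->
  (mrestr m mD).-integrable E (EFin \o f).
Proof.
move=> mE mf /integrableP[_ foo]; have mDc := measurableC mD.
apply/integrableP; split; first exact/measurable_EFinP.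
rewrite (ge0_negligible_integral mDc mE)//; last 2 first.
- by apply: measurableT_comp => //; exact/measurable_EFinP.
- by rewrite [LHS](_ : _ = m (~` D `&` D))// setICl measure0.
rewrite setDE setCK; apply: le_lt_trans foo.
rewrite le_eqVlt; apply/orP; left; apply/eqP.
apply: eq_measure_integral => A mA AED.
by rewrite /= /mrestr; congr (m _); apply/setIidPl => x /AED[].
Qed.

End Rintegral_measures.

(** * Dilations of balls, volumes of balls, and nullity of spheres *)

Section ball_scaling.
Context {R : realType} {n : nat}.
Implicit Types (f g : 'rV[R]_n -> R) (x : 'rV[R]_n).

Definition ball_integral f (r : R) : R := \int[lebesgue_rV n]_(x in eball n r) f x.

Definition sphere_integral f (r : R) : R :=
  \int[surface_measure n r]_(x in esphere n r) f x.

Lemma scale_preimage_eball (a r : R) : 0 < a ->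
  (fun x => a *: x) @^-1` (eball n (a * r)) = eball n r :> set 'rV[R]_n.
Proof.
by move=> a0; apply/seteqP; split => x; rewrite /eball/= enormZ gtr0_norm// ltr_pM2l.
Qed.

(** Meant for the extension of a function from a sphere as a function homogeneous of degree 0: the
    integrand is invariant under the dilation, and only the scaling of the measure is left. *)
Lemma ball_integral_scale g (a r M : R) : 0 < a ->
  measurable_fun setT g -> (forall x, `|g x| <= M) -> (forall x, g (a *: x) = g x) ->
  ball_integral g (a * r) = a ^+ n * ball_integral g r.
Proof.
move=> a0 mg gM ga.
have an0 : 0 <= a ^+ n by rewrite exprn_ge0// ltW.
have ms := @measurable_scale_rV R n a.
have mB := @measurable_eball R n.
have gi : (lebesgue_rV n).-integrable (eball n r) (EFin \o g).
  by apply: (@bounded_integrable_eball _ _ _ _ M).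
rewrite /ball_integral -[RHS](@Rintegral_mscale _ _ _ _ (NngNum an0))//; congr fine.
have gE : (EFin \o g) \o (fun x => a *: x) = EFin \o g.
  by apply/funext => x /=; rewrite ga.
rewrite -(scale_preimage_eball r a0) -[X in _ = integral _ _ X]gE.
have gi' : (mscale (NngNum an0) (lebesgue_rV n)).-integrable
    ((fun x => a *: x) @^-1` eball n (a * r)) ((EFin \o g) \o (fun x => a *: x)).
  by rewrite scale_preimage_eball// gE; exact: integrable_mscale.
apply: (etrans _ (integral_pushforward ms _ gi' (mB _))); last exact/measurable_EFinP.
apply: eq_measure_integral => A mA _.
rewrite /pushforward [RHS](_ : _ = (a ^+ n)%:E * lebesgue_rV n ((fun x => a *: x)%R @^-1` A))%E//.
rewrite lebesgue_rV_scale// muleA -EFinM divff ?mul1e//.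
by rewrite gt_eqF// exprn_gt0.
Qed.

Definition ball_volume (r : R) := fine (lebesgue_rV n (eball n r)).

Lemma ball_volumeK r : (ball_volume r)%:E = lebesgue_rV n (eball n r).
Proof. by rewrite fineK// ge0_fin_numE//; exact: lebesgue_eball_lty. Qed.

Lemma eball_eq0 r : r <= 0 -> eball n r = set0 :> set 'rV[R]_n.
Proof.
move=> r0; apply/seteqP; split => // x; rewrite /eball/= => /lt_le_trans /(_ r0).
by rewrite ltNge enorm_ge0.
Qed.

Lemma ball_volumeE r : (0 < n)%N -> 0 <= r -> ball_volume r = r ^+ n * ball_volume 1.
Proof.
move=> n0; rewrite le_eqVlt => /predU1P[<-|r0].
  by rewrite expr0n gtn_eqF// mul0r /ball_volume eball_eq0// measure0.
rewrite -[in LHS](mulr1 r).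
have := lebesgue_rV_scale r0 (@measurable_eball R n (r * 1)).
rewrite scale_preimage_eball// -!ball_volumeK -EFinM => -[->].
by rewrite mulrA divff ?mul1r// gt_eqF// exprn_gt0.
Qed.

Lemma ball_volume1_gt0 : (0 < n)%N -> 0 < ball_volume 1.
Proof.
move=> n0; rewrite -lte_fin ball_volumeK.
(* The cube of half-side [c] lies in the unit ball: each squared coordinate is at most
   [c ^+ 2 <= c], and [n%:R * c = 1 / 2]. *)
pose c : R := (2 * n%:R)^-1.
have c0 : 0 < c by rewrite invr_gt0 mulr_gt0// ltr0n.
apply: (@lt_le_trans _ _ (lebesgue_rV n
    [set x : 'rV[R]_n | forall i, (`]- c, c[%classic : set R) (x 0 i)])).
  rewrite (lebesgue_rV_box (A := fun=> `]- c, c[%classic)) => [|i]; last exact: measurable_itv.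
  rewrite (eq_bigr (fun=> (2 * c)%:E)); last first.
    move=> i _; rewrite lebesgue_measure_itv/= lte_fin gtrN// -EFinD opprK.
    by rewrite mulr_natl mulr2n.
  by rewrite prodEFin lte_fin; apply: prodr_gt0 => i _; rewrite mulr_gt0.
apply: le_measure; rewrite ?inE; [|exact: measurable_eball|].
  by apply: (@measurable_box _ _ (fun=> _)) => i; exact: measurable_itv.
move=> x xc; rewrite /eball/= -(ltr_pXn2r (n := 2))// ?nnegrE ?enorm_ge0//.
rewrite enorm_sqr expr1n.
apply: (@le_lt_trans _ _ (\sum_(i < n) c)).
  apply: ler_sum => i _; rewrite -real_normK ?num_real//.
  have : `|x 0 i| <= c by have := xc i; rewrite /= in_itv/= -ltr_norml => /ltW.
  move=> xic; apply: (@le_trans _ _ (c ^+ 2)).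
    by rewrite lerXn2r// nnegrE ltW.
  rewrite expr2 ler_piMl// ?ltW// /c invf_lt1 ?mulr_gt0 ?ltr0n//.
  by rewrite -natrM ltr1n mul2n -addnn; case: n n0 => // k _; rewrite addnS ltnS addSn.
rewrite sumr_const card_ord -mulr_natr /c.
have -> : (2 * n%:R : R)^-1 * n%:R = 2^-1.
  by field; rewrite pnatr_eq0 -lt0n.
by rewrite invf_lt1// ltr1n.
Qed.

(** For every [e > r] the sphere and the open ball it bounds are disjoint subsets of the ball of
    radius [e], so the sphere has measure at most [(e ^+ n - r ^+ n) * ball_volume 1], which tends
    to 0 as [e] decreases to [r]. *)
Lemma lebesgue_esphere r : (0 < n)%N -> 0 <= r ->
  lebesgue_rV n (esphere n r : set 'rV[R]_n) = 0%E.
Proof.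
move=> n0 r0; apply/eqP; rewrite eq_le measure_ge0 andbT.
have Sr : (lebesgue_rV n (esphere n r) <= lebesgue_rV n (eball n (r + 1)))%E.
  apply: le_measure; rewrite ?inE; [exact: measurable_esphere|exact: measurable_eball|].
  by move=> x; rewrite /eball/= => ->; rewrite ltrDl.
have Sfin : lebesgue_rV n (esphere n r) \is a fin_num.
  rewrite ge0_fin_numE//; exact: (le_lt_trans Sr (lebesgue_eball_lty _)).
rewrite -(fineK Sfin) lee_fin.
have key e : r < e ->
    fine (lebesgue_rV n (esphere n r)) <= (e ^+ n - r ^+ n) * ball_volume 1.
  move=> re; rewrite mulrBl -!ball_volumeE//; last exact: (le_trans r0 (ltW re)).
  rewrite lerBrDr -lee_fin EFinD fineK// !ball_volumeK -measureU//; last 3 first.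
  - exact: measurable_esphere.
  - exact: measurable_eball.
  - apply/seteqP; split => // x; rewrite /esphere /eball/= => -[->].
    by rewrite ltxx.
  apply: le_measure; rewrite ?inE.
  - by apply: measurableU; [exact: measurable_esphere|exact: measurable_eball].
  - exact: measurable_eball.
  - move=> x; rewrite /esphere /eball/= => -[->//|xr]; exact: lt_trans re.
have : (e ^+ n - r ^+ n) * ball_volume 1 @[e --> r^'+] --> (r ^+ n - r ^+ n) * ball_volume 1.
  apply: cvg_at_right_filter; apply: cvgM; last exact: cvg_cst.
  by apply: cvgB; [exact: exprn_continuous|exact: cvg_cst].
rewrite subrr mul0r => /cvgr_to_ge; apply.
by near=> e; apply: key; near: e; exact: nbhs_right_gt.
Unshelve. all: by end_near. Qed.

End ball_scaling.
Arguments ball_volume {R} n r.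

(** * Integrals over spheres *)

Section sphere_integral_theory.
Context {R : realType} {n : nat}.
Implicit Types (f g : 'rV[R]_n -> R) (x : 'rV[R]_n) (r : R).

Lemma enorm_sphere_proj r x : 0 <= r -> x != 0 -> enorm (sphere_proj r x) = r.
Proof.
move=> r0 x0; rewrite /sphere_proj enormZ ger0_norm ?divr_ge0 ?enorm_ge0//.
by rewrite divfK// enorm_eq0.
Qed.

Lemma enorm_sphere_proj_le r x : 0 <= r -> enorm (sphere_proj r x) <= r.
Proof.
move=> r0; have [->|x0] := eqVneq x 0; last by rewrite enorm_sphere_proj.
by rewrite /sphere_proj scaler0 enorm0.
Qed.

Lemma measurable_comp_sphere_proj f r : continuous f ->
  measurable_fun setT (f \o sphere_proj r).
Proof.
move=> cf; apply: measurableT_comp; last exact: measurable_sphere_proj.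
exact: continuous_measurable_rV.
Qed.

Lemma bounded_comp_sphere_proj f r : 0 <= r -> continuous f ->
  exists M, forall x, `|(f \o sphere_proj r) x| <= M.
Proof.
move=> r0 /(continuous_bounded_cball r)[M fM]; exists M => x.
by apply: fM; exact: enorm_sphere_proj_le.
Qed.

Lemma integrable_comp_sphere_proj f r s : 0 <= r -> continuous f ->
  (lebesgue_rV n).-integrable (eball n s) (EFin \o (f \o sphere_proj r)).
Proof.
move=> r0 cf; have [M fM] := bounded_comp_sphere_proj r0 cf.
apply: (@bounded_integrable_eball _ _ _ _ M) => //.
exact: measurable_comp_sphere_proj.
Qed.

(** Change of variables in the cone measure. It turns statements about spheres into statements about
    Lebesgue measure on balls. *)
Lemma sphere_integralE f r : (0 < n)%N -> 0 < r -> continuous f ->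
  sphere_integral f r = n%:R / r * ball_integral (f \o sphere_proj r) r.
Proof.
move=> n0 r0 cf; have mf := continuous_measurable_rV cf.
have mp := @measurable_sphere_proj R n r.
have mpb := @measurable_punctured_ball R n r.
have mS := @measurable_esphere R n r.
have mpS : measurable (sphere_proj r @^-1` esphere n r : set 'rV[R]_n).
  by rewrite -[X in measurable X]setTI; exact: mp.
have mfp := @measurable_comp_sphere_proj f r cf.
have pbS : sphere_proj r @^-1` esphere n r `&` punctured_ball r = punctured_ball r :> set 'rV[R]_n.
  apply/setIidPr => x /andP[x0 _]; apply: enorm_sphere_proj; first exact: ltW.
  by rewrite -enorm_eq0 gt_eqF.
have fi_pb : (lebesgue_rV n).-integrable (punctured_ball r) (EFin \o (f \o sphere_proj r)).
  apply: (@integrableS _ _ _ _ (eball n (r + 1))) => //; first exact: measurable_eball.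
    by move=> x /andP[_ xr]; rewrite /eball/= (le_lt_trans xr)// ltrDl.
  by apply: integrable_comp_sphere_proj => //; exact: ltW.
have fi_m : (mrestr (lebesgue_rV n) mpb).-integrable
    (sphere_proj r @^-1` esphere n r) (EFin \o (f \o sphere_proj r)).
  apply: integrable_mrestr => //; first exact: measurable_funTS.
  by rewrite pbS.
have fi_s : (sphere_pushforward r).-integrable (esphere n r) (EFin \o f).
  by apply: (@integrable_pushforward _ _ _ _ _ _ mp) => //; exact/measurable_EFinP.
rewrite /sphere_integral /surface_measure Rintegral_mscale//=.
rewrite gtr0_norm//; congr (_ * _).
transitivity (\int[mrestr (lebesgue_rV n) mpb]_(x in sphere_proj r @^-1` esphere n r)
    (f \o sphere_proj r) x).
  congr fine; apply: (@integral_pushforward _ _ _ _ _ _ mp) => //.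
  exact/measurable_EFinP.
rewrite Rintegral_mrestr// pbS.
(* The punctured closed ball and the open ball differ only at the origin, which is the sphere of
   radius 0, and on the sphere of radius [r]; both are null. *)
pose N : set 'rV[R]_n := esphere n 0 `|` esphere n r.
have mN : measurable N by apply: measurableU => //; exact: measurable_esphere.
have N0 : lebesgue_rV n N = 0%E.
  rewrite /N measureU0; [exact: lebesgue_esphere|exact: measurable_esphere|by []|].
  by apply: lebesgue_esphere => //; exact: ltW.
rewrite /ball_integral /Rintegral (negligible_integral mN)//.
rewrite [in RHS](negligible_integral mN)//; last 2 first.
- exact: measurable_eball.
- by apply: integrable_comp_sphere_proj => //; exact: ltW.
congr (fine (integral _ _ _)); apply/seteqP; split => x [] /=.
  move=> /andP[x0 xr] /not_orP[xn0 /eqP xnr]; split; first by rewrite /eball/= lt_neqAle xnr.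
  by case => //; move/eqP : xnr.
move=> xr Nx; split => //; apply/andP; split; last exact: ltW.
rewrite lt_neqAle enorm_ge0 andbT eq_sym; apply/negP => /eqP x0.
by apply: Nx; left.
Qed.

Lemma ball_integral_annulus f r s : r <= s ->
  (lebesgue_rV n).-integrable (eball n s) (EFin \o f) ->
  ball_integral f s - ball_integral f r =
  \int[lebesgue_rV n]_(x in eball n s `\` eball n r) f x.
Proof.
move=> rs fi.
have sU : eball n s = eball n r `|` (eball n s `\` eball n r) :> set 'rV[R]_n.
  by rewrite setDUK// => x; rewrite /eball/= => /lt_le_trans; exact.
have mA : measurable (eball n s `\` eball n r : set 'rV[R]_n).
  by apply: measurableD; exact: measurable_eball.
have fiU : (lebesgue_rV n).-integrable (eball n r `|` (eball n s `\` eball n r)) (EFin \o f).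
  by rewrite -sU.
have dis : [disjoint (eball n r : set 'rV[R]_n) & eball n s `\` eball n r].
  by apply/disj_setPS => x [? []].
have := Rintegral_setU (@measurable_eball R n r) mA fiU dis.
by rewrite -sU => sE; rewrite [in LHS]/ball_integral sE addrC addKr.
Qed.

Lemma ball_integral_annulus_le f g r s e : (0 < n)%N -> 0 <= r -> r <= s ->
  (lebesgue_rV n).-integrable (eball n s) (EFin \o f) ->
  (lebesgue_rV n).-integrable (eball n s) (EFin \o g) ->
  (forall x, r <= enorm x < s -> `|f x - g x| <= e) ->
  `|(ball_integral f s - ball_integral f r) - (ball_integral g s - ball_integral g r)|
  <= e * ((s ^+ n - r ^+ n) * ball_volume n 1).
Proof.
move=> n0 r0 rs fi gi fge.
have mA : measurable (eball n s `\` eball n r : set 'rV[R]_n).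
  by apply: measurableD; exact: measurable_eball.
have As : eball n s `\` eball n r `<=` (eball n s : set 'rV[R]_n) by move=> x [].
have fi' := integrableS (measurable_eball s) mA As fi.
have gi' := integrableS (measurable_eball s) mA As gi.
have ci a : (lebesgue_rV n).-integrable (eball n s) (EFin \o (fun=> a) : 'rV[R]_n -> \bar R).
  by apply: (@bounded_integrable_eball _ _ _ _ `|a|).
have fgi : (lebesgue_rV n).-integrable (eball n s `\` eball n r) (EFin \o (fun x => f x - g x)).
  exact: (integrableB mA fi' gi').
rewrite !ball_integral_annulus// -RintegralB//.
apply: (le_trans (le_normr_Rintegral mA fgi)).
apply: (@le_trans _ _ (\int[lebesgue_rV n]_(x in eball n s `\` eball n r) e)).
  apply: le_Rintegral => //.
  - exact: (integrable_norm fgi).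
  - exact: (integrableS (measurable_eball s) mA As (ci e)).
  - by move=> x [xs /negP]; rewrite -leNgt => xr; apply: fge; rewrite xr.
rewrite Rintegral_cst// le_eqVlt; apply/orP; left; apply/eqP; congr (_ * _).
have := ball_integral_annulus rs (ci 1).
rewrite /ball_integral !Rintegral_cst//; try exact: measurable_eball.
rewrite !mul1r -!/(ball_volume _ _) => <-.
rewrite (@ball_volumeE _ _ s)// ?(le_trans r0)// (@ball_volumeE _ _ r)//.
by rewrite mulrBl.
Qed.

End sphere_integral_theory.

(** * Differentiation of ball integrals with respect to the radius *)

Section ball_integral_derivative.
Context {R : realType} {n : nat}.
Implicit Types (f g : 'rV[R]_n -> R) (x : 'rV[R]_n) (r : R).

Lemma sphere_projZ r a x : 0 < a -> sphere_proj r (a *: x) = sphere_proj r x.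
Proof.
move=> a0; have [->|x0] := eqVneq x 0; first by rewrite scaler0.
rewrite /sphere_proj enormZ gtr0_norm// scalerA; congr (_ *: _).
have ex0 : enorm x != 0 by rewrite enorm_eq0.
by field; rewrite ex0 gt_eqF.
Qed.

(** Compactness of the sphere makes [f (t *: y)] close to [f y] uniformly in [y] for [t] near 1, and
    a point [x] of a thin annulus is [t *: y] with [y] its projection and [t = enorm x / r]. The
    [min] and [max] allow [s] on either side of [r]. *)
Lemma near_sphere_proj f r e : 0 < r -> 0 < e -> continuous f ->
  \forall s \near r, forall x, Num.min r s <= enorm x <= Num.max r s ->
    `|f x - f (sphere_proj r x)| < e.
Proof.
move=> r0 e0 cf.
pose P (t : R) x := `|f (t *: x) - f x| < e.
have cF : continuous (fun p : 'rV[R]_n * R => f (p.2 *: p.1) - f p.1).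
  apply: continuous_sub => p.
    apply: (@continuous_comp _ _ _ (fun p : 'rV[R]_n * R => p.2 *: p.1) f); last exact: cf.
    by apply: cvgZ; [exact: cvg_snd|exact: cvg_fst].
  by apply: (@continuous_comp _ _ _ fst f); [exact: cvg_fst|exact: cf].
have /nbhs_ballP[d /= d0 dP] : \forall t \near (1 : R), esphere n r `<=` P t.
  have /compact_near_coveringP/(_ R (nbhs (1 : R)) P _) := @compact_esphere R n r.
  apply => x xr.
  have := cF (x, 1); rewrite /continuous_at/= scale1r subrr => /cvgr0_norm_lt /(_ _ e0).
  by [].
near=> s.
move=> x xrs.
have s0 : 0 < s by near: s; exact: lt_nbhsr.
(* The ratio [enorm x / r] differs from 1 by at most [|r - s| / r], which has to be less than
   [d]. *)
have srd : `|r - s| < d * r.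
  near: s; apply/nbhs_ballP; exists (d * r) => //=; exact: mulr_gt0.
have x0 : 0 < enorm x by case/andP : xrs => + _; apply: lt_le_trans; rewrite lt_min r0.
have xE : x = (enorm x / r) *: sphere_proj r x.
  by rewrite /sphere_proj scalerA mulrA divfK ?gt_eqF// divff ?gt_eqF// scale1r.
rewrite [X in f X - _]xE.
apply: dP => /=; last by rewrite /esphere/= enorm_sphere_proj ?ltW// -enorm_eq0 gt_eqF.
rewrite /ball/= -(ltr_pM2r r0); apply: le_lt_trans srd.
rewrite -[X in _ * X]gtr0_norm// -normrM mulrBl mul1r divfK ?gt_eqF//.
have := ler_norm (r - s); have := ler_norm (s - r); rewrite distrC => rs1 rs2.
move: xrs => /andP[]; rewrite ge_min le_max => /orP[] h1 /orP[] h2;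
  rewrite ler_norml; apply/andP; split; clear -h1 h2 rs1 rs2; lra.
Unshelve. all: by end_near. Qed.

(* f is compared with its extension x |-> f (r x / |x|), homogeneous of degree 0,
   whose integral over the ball of radius s is proportional to s ^ n. *)
Lemma is_derive_ball_integral f r : (0 < n)%N -> 0 < r -> continuous f ->
  is_derive r 1 (ball_integral f) (sphere_integral f r).
Proof.
move=> n0 r0 cf; pose g := f \o sphere_proj r.
have [M gM] := bounded_comp_sphere_proj (ltW r0) cf.
have gi s : (lebesgue_rV n).-integrable (eball n s) (EFin \o g).
  by apply: integrable_comp_sphere_proj => //; exact: ltW.
have fi s := @continuous_integrable_eball _ _ f s cf.
pose c := r ^- n * ball_integral g r.
have gE s : 0 < s -> ball_integral g s = c * s ^+ n.
  move=> s0; have -> : s = (s / r) * r by rewrite divfK ?gt_eqF.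
  rewrite (@ball_integral_scale _ _ _ (s / r) r M) ?divr_gt0//; last 2 first.
  - exact: measurable_comp_sphere_proj.
  - by move=> x; rewrite /g/= sphere_projZ ?divr_gt0.
  by rewrite divfK ?gt_eqF// exprMn exprVn /c; ring.
have dX : is_derive r 1 (fun s : R => c * s ^+ n) (c * (n%:R * r ^+ n.-1)).
  have dXn : is_derive r 1 (fun s : R => s ^+ n) (n%:R * r ^+ n.-1).
    apply: DeriveDef; first exact: exprn_derivable.
    by rewrite exp_derive /GRing.scale/= mulr1.
  exact: is_deriveZ.
(* [f] and [g] are uniformly close on the annulus between the radii [r] and [s], whose volume is of
   order [|s - r|], so the increment of the difference of their ball integrals is negligible with
   respect to [s - r]. *)
have dD : is_derive r 1 (fun s => ball_integral f s - c * s ^+ n) 0.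
  have hr : (h *: (1 : R) + r) @[h --> (0 : R)^'] --> r.
    rewrite -[X in _ --> X]add0r -[X in _ --> X + _](scale0r (1 : R)).
    apply: cvg_within_filter; apply: cvgD; last exact: cvg_cst.
    by apply: cvgZl; exact: cvg_id.
  suff h0 : h^-1 *: (((fun s => ball_integral f s - c * s ^+ n) \o shift r) (h *: 1) -
      (ball_integral f r - c * r ^+ n)) @[h --> (0 : R)^'] --> (0 : R).
    by apply: DeriveDef; [apply/cvg_ex; exists 0|exact: cvg_lim].
  have [l hl] : exists l : R, h^-1 *: ((h *: 1 + r) ^+ n - r ^+ n) @[h --> (0 : R)^'] --> l.
    by have /cvg_ex := @exprn_derivable R n r 1.
  have V0 : 0 < ball_volume n (1 : R) := ball_volume1_gt0 n0.
  apply/cvgr0Pnorm_lt => e e0.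
  have l1 : 0 < `|l| + 1 by rewrite (lt_le_trans ltr01)// lerDr.
  (* [|l| + 1] bounds the difference quotients of [s ^+ n] near [r]; multiplied by [ball_volume n 1]
     it bounds the volume of the annulus divided by [|h|]. *)
  pose e' := e / (ball_volume n 1 * (`|l| + 1)).
  have e'0 : 0 < e' := divr_gt0 e0 (mulr_gt0 V0 l1).
  have nf := hr _ (near_sphere_proj r0 e'0 cf).
  have ns : \forall h \near (0 : R)^', 0 < h *: 1 + r.
    exact: (hr _ (lt_nbhsr r0)).
  have nl : \forall h \near (0 : R)^', `|h^-1 *: ((h *: 1 + r) ^+ n - r ^+ n)| < `|l| + 1.
    have L : `|l| < `|l| + 1 by rewrite ltrDl.
    exact: (cvgr_norm_lt _ hl _ L).
  near=> h.
  have s0 : 0 < h *: 1 + r by near: h.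
  have sf : forall x, Num.min r (h *: 1 + r) <= enorm x <= Num.max r (h *: 1 + r) ->
    `|f x - g x| < e' by near: h.
  have sl : `|h^-1 *: ((h *: 1 + r) ^+ n - r ^+ n)| < `|l| + 1 by near: h.
  have hn0 : h != 0 by near: h; exact: nbhs_dnbhs_neq.
  move: s0 sf sl; rewrite /=; set s := h *: 1 + r => s0 sf sl.
  have sn0 := ltW s0; have rn0 := ltW r0.
  have key : `|ball_integral f s - c * s ^+ n - (ball_integral f r - c * r ^+ n)|
      <= e' * (`|s ^+ n - r ^+ n| * ball_volume n 1).
    rewrite -!gE//; have [rs|/ltW sr] := leP r s.
      rewrite [X in `|X|](_ : _ = ball_integral f s - ball_integral f r -
        (ball_integral g s - ball_integral g r)); last by ring.
      rewrite [X in _ <= _ * (X * _)]ger0_norm ?subr_ge0 ?lerXn2r ?nnegrE//.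
      apply: ball_integral_annulus_le => //.
      move=> x /andP[rx xs]; apply/ltW/sf.
      by rewrite ge_min rx le_max (ltW xs) orbT.
    rewrite -normrN [X in `|X|](_ : _ = ball_integral f r - ball_integral f s -
      (ball_integral g r - ball_integral g s)); last by ring.
    rewrite [X in _ * (X * _)]distrC [X in _ <= _ * (X * _)]ger0_norm ?subr_ge0 ?lerXn2r ?nnegrE//.
    apply: ball_integral_annulus_le => //.
    move=> x /andP[sx xr]; apply/ltW/sf.
    by rewrite ge_min sx orbT le_max (ltW xr).
  rewrite normrZ; apply: (@le_lt_trans _ _
    (`|h^-1| * (e' * (`|s ^+ n - r ^+ n| * ball_volume n 1)))).
    by rewrite ler_wpM2l.
  rewrite [X in X < _](_ : _ = e' * ball_volume n 1 * (`|h^-1| * `|s ^+ n - r ^+ n|)); last by ring.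
  have := sl; rewrite normrZ -(ltr_pM2l (mulr_gt0 e'0 V0)) => /lt_le_trans; apply.
  rewrite /e' le_eqVlt; apply/orP; left; apply/eqP; field.
  by rewrite !gt_eqF.
have : is_derive r 1 ((fun s => ball_integral f s - c * s ^+ n) + (fun s : R => c * s ^+ n))
   (0 + c * (n%:R * r ^+ n.-1)) by exact: is_deriveD.
rewrite add0r (_ : _ + _ = ball_integral f); last by apply/funext => s /=; rewrite [LHS]subrK.
rewrite sphere_integralE// -/g (_ : c * _ = n%:R / r * ball_integral g r)// /c.
have rk : r ^+ n.-1 != 0 by rewrite expf_neq0// gt_eqF.
by rewrite -[in r ^- n](prednK n0) exprS; field; rewrite rk gt_eqF.
Unshelve. all: by end_near. Qed.

End ball_integral_derivative.

(** * The divergence theorem on balls *)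

Section fubini_cons.
Context {R : realType} {n : nat}.

Lemma integrable_comp_cons_rV (f : 'rV[R]_n.+1 -> R) :
  (lebesgue_rV n.+1).-integrable setT (EFin \o f) ->
  (lebesgue_measure \x lebesgue_rV n)%E.-integrable setT (EFin \o (f \o @cons_rV R n)).
Proof.
move=> fi; have [mf foo] := integrableP _ _ _ fi.
apply/integrableP; split.
  apply: (measurableT_comp mf); exact: measurable_cons_rV.
apply: le_lt_trans foo; rewrite le_eqVlt; apply/orP; left; apply/eqP.
apply/esym/(ge0_integral_pushforward (@measurable_cons_rV R n)) => //.
exact: measurableT_comp.
Qed.

Lemma integral_cons_rV (f : 'rV[R]_n.+1 -> R) :
  (lebesgue_rV n.+1).-integrable setT (EFin \o f) ->
  (\int[lebesgue_rV n.+1]_x (f x)%:E =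
   \int[lebesgue_measure \x lebesgue_rV n]_p (f (cons_rV p))%:E)%E.
Proof.
move=> fi; apply: (integral_pushforward (@measurable_cons_rV R n)) => //.
  exact: measurable_int fi.
exact: integrable_comp_cons_rV.
Qed.

Lemma Fubini_cons_rV1 (f : 'rV[R]_n.+1 -> R) :
  (lebesgue_rV n.+1).-integrable setT (EFin \o f) ->
  (\int[lebesgue_rV n.+1]_x (f x)%:E =
   \int[lebesgue_measure]_t \int[lebesgue_rV n]_y (f (cons_rV (t, y)))%:E)%E.
Proof.
move=> fi; rewrite integral_cons_rV//.
by rewrite -(integral12_prod_meas1 (integrable_comp_cons_rV fi)).
Qed.

Lemma Fubini_cons_rV2 (f : 'rV[R]_n.+1 -> R) :
  (lebesgue_rV n.+1).-integrable setT (EFin \o f) ->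
  (\int[lebesgue_rV n.+1]_x (f x)%:E =
   \int[lebesgue_rV n]_y \int[lebesgue_measure]_t (f (cons_rV (t, y)))%:E)%E.
Proof.
move=> fi; rewrite integral_cons_rV//.
by rewrite -(integral21_prod_meas1 (integrable_comp_cons_rV fi)).
Qed.

End fubini_cons.

Lemma continuous_rV (R : realType) (T : topologicalType) n (f : T -> 'rV[R]_n) :
  (forall i, continuous (fun t => f t 0 i)) -> continuous f.
Proof.
move=> cf t A [P tP PA]; rewrite /nbhs/=.
apply: (@filterS _ _ _ [set s | forall i, P 0 i (f s 0 i)]).
  by move=> s Ps; apply: PA => i j; rewrite ord1.
by apply: filter_forall => i; apply: cf; exact: tP.
Qed.

(** The two difference quotients are equal. Only the increments of [p] along [w] matter, so
    directional derivatives pass to slices, lines and translates without any differentiability of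
    [f] as a function of several variables. *)
Lemma is_derive_comp_affine (R : realType) (V W : normedModType R) (f : V -> R)
    (p : W -> V) (w x : W) (v : V) (d : R) :
  (forall h : R, p (h *: w + x) = h *: v + p x) ->
  is_derive (p x) v f d -> is_derive x w (f \o p) d.
Proof.
move=> pE [df fd].
have E : (fun h => h^-1 *: (((f \o p) \o shift x) (h *: w) - (f \o p) x)) =
         (fun h => h^-1 *: ((f \o shift (p x)) (h *: v) - f (p x))).
  by apply/funext => h /=; rewrite pE.
by split; rewrite /derivable /derive E.
Qed.

Section ball_integral_partial.
Context {R : realType}.

Lemma cons_rVD n (h t : R) (v y : 'rV[R]_n) (s : R) :
  cons_rV (h * s + t, h *: v + y) = h *: cons_rV (s, v) + cons_rV (t, y).
Proof.
apply/rowP => i; rewrite [RHS]mxE [X in _ = X + _]mxE.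
have [->|] := eqVneq i 0; first by rewrite !cons_rV0.
by rewrite eq_sym => /unlift_some[j -> _]; rewrite !cons_rVS/= !mxE.
Qed.

Lemma cons_rV_delta0 n : cons_rV (1, 0) = delta_mx 0 0 :> 'rV[R]_n.+1.
Proof.
apply/rowP => i; have [->|] := eqVneq i 0; first by rewrite cons_rV0 !mxE eqxx.
by rewrite eq_sym => /unlift_some[j -> _]; rewrite cons_rVS !mxE.
Qed.

Lemma cons_rV_deltaS n (j : 'I_n) :
  cons_rV (0, delta_mx 0 j) = delta_mx 0 (lift ord0 j) :> 'rV[R]_n.+1.
Proof.
apply/rowP => i; have [->|] := eqVneq i 0; first by rewrite cons_rV0 !mxE.
rewrite eq_sym => /unlift_some[k -> _]; rewrite cons_rVS !mxE.
by rewrite (inj_eq lift_inj).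
Qed.

Lemma continuous_cons_rVl n (y : 'rV[R]_n) : continuous (fun t : R => cons_rV (t, y)).
Proof.
apply: continuous_rV => i; have [->|] := eqVneq i 0.
  rewrite (_ : (fun _ => _) = id); first by move=> t; exact: cvg_id.
  by apply/funext => t; rewrite cons_rV0.
rewrite eq_sym => /unlift_some[j -> _].
rewrite (_ : (fun _ => _) = cst (y 0 j)); first exact: cst_continuous.
by apply/funext => t; rewrite cons_rVS.
Qed.

Lemma continuous_cons_rVr n (t : R) : continuous (fun y : 'rV[R]_n => cons_rV (t, y)).
Proof.
apply: continuous_rV => i; have [->|] := eqVneq i 0.
  rewrite (_ : (fun _ => _) = cst t); first exact: cst_continuous.
  by apply/funext => y; rewrite cons_rV0.
rewrite eq_sym => /unlift_some[j -> _].
rewrite (_ : (fun _ => _) = fun y : 'rV[R]_n => y 0 j); first exact: continuous_coord.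
by apply/funext => y; rewrite cons_rVS.
Qed.

Lemma enorm_cons_rV n (t : R) (y : 'rV[R]_n) :
  enorm (cons_rV (t, y)) ^+ 2 = t ^+ 2 + enorm y ^+ 2.
Proof.
rewrite !enorm_sqr big_ord_recl cons_rV0; congr (_ + _).
by apply: eq_bigr => i _; rewrite cons_rVS.
Qed.

End ball_integral_partial.

Section ball_integral_of_partial.
Context {R : realType}.

Lemma integral_chord_derive (F G : R -> R) (s : R) : 0 < s ->
  continuous G -> (forall t : R, is_derive t 1 F (G t)) -> F (- s) = F s ->
  (\int[lebesgue_measure]_(t in `](- s)%R, s[) (G t)%:E = 0)%E.
Proof.
move=> s0 cG dF Fs.
have cF : continuous F.
  by move=> t; apply/differentiable_continuous/derivable1_diffP; case: (dF t).
have mG : measurable_fun `]- s, s[ (EFin \o G).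
  by apply/measurable_EFinP/measurable_funTS; exact: continuous_measurable_fun.
have := @integral_itv_bndoo R (- s) s (EFin \o G) true false mG.
move=> /= <-.
rewrite (@continuous_FTC2 _ G F)//.
- by rewrite Fs subee.
- by rewrite gtrN.
- exact: continuous_subspaceT.
- split => [t _||]; first by case: (dF t).
    exact/cvg_at_right_filter/cF.
  exact/cvg_at_left_filter/cF.
- by move=> t _; rewrite derive1E; case: (dF t).
Qed.

(* By induction on n: the slices of a ball orthogonal to the first axis are balls,
   those parallel to it are chords, to which the fundamental theorem of calculus
   applies. *)
Lemma ball_integral_derive_vanish n (i : 'I_n) (f g : 'rV[R]_n -> R) (r : R) :
  continuous g -> (forall x, is_derive x (delta_mx 0 i : 'rV[R]_n) f (g x)) ->
  (forall x, enorm x = r -> f x = 0) -> ball_integral g r = 0.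
Proof.
elim: n i f g r => [[]//|n IH] i f g r cg df f0.
have [r0|r0] := leP r 0; first by rewrite /ball_integral eball_eq0// Rintegral_set0.
have mB := @measurable_eball R.
have gi := @continuous_integrable_eball R n.+1 g r cg.
have gpi : (lebesgue_rV n.+1).-integrable setT (EFin \o (g \_ (eball n.+1 r))).
  by rewrite -restrict_EFin; apply/(integrable_mkcond _ (mB _ r)).
have eballE t (y : 'rV[R]_n) : eball n.+1 r (cons_rV (t, y)) <-> t ^+ 2 + enorm y ^+ 2 < r ^+ 2.
  by rewrite -enorm_cons_rV /eball/= ltr_pXn2r ?nnegrE ?enorm_ge0// ltW.
rewrite /ball_integral Rintegral_mkcond /Rintegral.
suff -> : (\int[lebesgue_rV n.+1]_x ((g \_ (eball n.+1 r)) x)%:E = 0)%E by [].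
case: (unliftP ord0 i) => [j|] ii; subst i.
  rewrite Fubini_cons_rV1//; apply: integral0_eq => t _.
  have [rt|tr] := leP (r ^+ 2) (t ^+ 2).
    apply: integral0_eq => y _; rewrite patchE memNset// eballE.
    by apply/negP; rewrite -leNgt (le_trans rt)// lerDl sqr_ge0.
  pose s := Num.sqrt (r ^+ 2 - t ^+ 2).
  have s2 : s ^+ 2 = r ^+ 2 - t ^+ 2 by rewrite sqr_sqrtr// subr_ge0 ltW.
  have s0 : 0 <= s by exact: sqrtr_ge0.
  have eballs (y : 'rV[R]_n) : eball n.+1 r (cons_rV (t, y)) <-> eball n s y.
    rewrite eballE /eball/= -[enorm y < s](ltr_pXn2r (n := 2)) ?nnegrE ?enorm_ge0//.
    by rewrite s2 ltrBrDl.
  have cgt : continuous (g \o (fun y : 'rV[R]_n => cons_rV (t, y))).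
    move=> y; apply: continuous_comp; [exact: continuous_cons_rVr|exact: cg].
  have dft (y : 'rV[R]_n) : is_derive y (delta_mx 0 j : 'rV[R]_n)
      (f \o (fun y : 'rV[R]_n => cons_rV (t, y))) (g (cons_rV (t, y))).
    apply: (is_derive_comp_affine (v := delta_mx 0 (lift ord0 j))) => a.
    by rewrite -cons_rV_deltaS -cons_rVD mulr0 add0r.
  have h : ball_integral (g \o (fun y : 'rV[R]_n => cons_rV (t, y))) s = 0.
    apply: (IH j _ _ _ cgt dft) => y ys; apply: f0; apply/eqP.
    rewrite -(eqrXn2 (n := 2))// ?enorm_ge0 ?ltW//.
    by rewrite enorm_cons_rV ys s2 addrC subrK.
  transitivity (\int[lebesgue_rV n]_(y in eball n s) (g (cons_rV (t, y)))%:E)%E.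
    rewrite [RHS]integral_mkcond; apply: eq_integral => y _.
    rewrite !patchE; have [/set_mem/eballs ys|ys] := boolP (cons_rV (t, y) \in eball n.+1 r).
      by rewrite mem_set.
    rewrite memNset// => /eballs/mem_set.
    by rewrite (negbTE ys).
  (* [h] only says that the real part [fine] of the integral is 0; finiteness excludes an infinite
     value, which [fine] also sends to 0. *)
  have fin := integrable_fin_num (mB _ s) (continuous_integrable_eball s cgt).
  by rewrite -(fineK fin); move: h; rewrite /ball_integral /Rintegral => ->.
rewrite Fubini_cons_rV2//; apply: integral0_eq => y _.
have [ry|yr] := leP (r ^+ 2) (enorm y ^+ 2).
  apply: integral0_eq => t _; rewrite patchE memNset// eballE.
  by apply/negP; rewrite -leNgt (le_trans ry)// lerDr sqr_ge0.
pose s := Num.sqrt (r ^+ 2 - enorm y ^+ 2).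
have s2 : s ^+ 2 = r ^+ 2 - enorm y ^+ 2 by rewrite sqr_sqrtr// subr_ge0 ltW.
have s0 : 0 < s by rewrite sqrtr_gt0 subr_gt0.
have eballs (t : R) : eball n.+1 r (cons_rV (t, y)) <-> `]- s, s[%classic t.
  rewrite eballE /= in_itv/= -ltr_norml -[_ < s](ltr_pXn2r (n := 2))// ?nnegrE ?ltW//.
  by rewrite s2 real_normK ?num_real// ltrBrDr.
transitivity (\int[lebesgue_measure]_(t in `](- s)%R, s[) (g (cons_rV (t, y)))%:E)%E.
  rewrite [RHS]integral_mkcond; apply: eq_integral => t _.
  rewrite !patchE; have [/set_mem/eballs ts|ts] := boolP (cons_rV (t, y) \in eball n.+1 r).
    by rewrite mem_set.
  rewrite memNset// => /eballs/mem_set.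
  by rewrite (negbTE ts).
have fs (t : R) : t ^+ 2 = s ^+ 2 -> f (cons_rV (t, y)) = 0.
  move=> ts; apply: f0; apply/eqP; rewrite -(eqrXn2 (n := 2))// ?enorm_ge0 ?ltW//.
  by rewrite enorm_cons_rV ts s2 subrK.
apply: (integral_chord_derive (F := f \o (fun t => cons_rV (t, y)))) => //.
- by move=> t; apply: continuous_comp; [exact: continuous_cons_rVl|exact: cg].
- move=> t; apply: (is_derive_comp_affine (v := delta_mx 0 0)) => a.
  by rewrite -cons_rV_delta0 -cons_rVD scaler0 add0r.
- by rewrite /= !fs// sqrrN.
Qed.

End ball_integral_of_partial.

Section divergence.
Context {R : realType} {n : nat}.
Implicit Types (r : R) (f g : 'rV[R]_n -> R).

Lemma ball_integralD f g r : continuous f -> continuous g ->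
  ball_integral (fun x => f x + g x) r = ball_integral f r + ball_integral g r.
Proof.
move=> cf cg; apply: RintegralD; [exact: measurable_eball|..];
  exact: continuous_integrable_eball.
Qed.

Lemma ball_integralZ (k : R) f r : continuous f ->
  ball_integral (fun x => k * f x) r = k * ball_integral f r.
Proof.
move=> cf; apply: RintegralZl; [exact: measurable_eball|].
exact: continuous_integrable_eball.
Qed.

Lemma ball_integral_sum m (F : 'I_m -> 'rV[R]_n -> R) r : (forall i, continuous (F i)) ->
  ball_integral (fun x => \sum_(i < m) F i x) r = \sum_(i < m) ball_integral (F i) r.
Proof.
elim: m F => [|m IH] F cF.
  rewrite big_ord0 /ball_integral (@eq_Rintegral _ _ _ _ _ (cst 0)).
    by rewrite Rintegral_cst ?mul0r//; exact: measurable_eball.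
  by move=> x _; rewrite big_ord0.
rewrite big_ord_recl -IH// -ball_integralD//; last exact: continuous_sum.
by apply: eq_Rintegral => x _; rewrite big_ord_recl.
Qed.

Lemma sphere_integral_ext f g r :
  (forall x, enorm x = r -> f x = g x) -> sphere_integral f r = sphere_integral g r.
Proof. by move=> fg; apply: eq_Rintegral => x /set_mem; exact: fg. Qed.

Lemma sphere_integralD f g r : (0 < n)%N -> 0 < r -> continuous f -> continuous g ->
  sphere_integral (fun x => f x + g x) r = sphere_integral f r + sphere_integral g r.
Proof.
move=> n0 r0 cf cg; rewrite !sphere_integralE//; last exact: continuous_add.
rewrite -mulrDr; congr (_ * _); apply: RintegralD; first exact: measurable_eball.
  by apply: integrable_comp_sphere_proj => //; exact: ltW.
by apply: integrable_comp_sphere_proj => //; exact: ltW.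
Qed.

Lemma continuous_scal (k : R) f : continuous f -> continuous (fun x => k * f x).
Proof. by move=> cf; apply: continuous_mul => //; exact: cst_continuous. Qed.

Lemma sphere_integralZ (k : R) f r : (0 < n)%N -> 0 < r -> continuous f ->
  sphere_integral (fun x => k * f x) r = k * sphere_integral f r.
Proof.
move=> n0 r0 cf; rewrite !sphere_integralE//; last exact: continuous_scal.
rewrite mulrCA; congr (_ * _); apply: RintegralZl; first exact: measurable_eball.
by apply: integrable_comp_sphere_proj => //; exact: ltW.
Qed.

Lemma sphere_integral_le f g r : (0 < n)%N -> 0 < r -> continuous f -> continuous g ->
  (forall x, enorm x = r -> f x <= g x) -> sphere_integral f r <= sphere_integral g r.
Proof.
move=> n0 r0 cf cg fg; rewrite -subr_ge0 -mulN1r -sphere_integralZ//.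
rewrite -sphere_integralD//; last exact: continuous_scal.
by apply: Rintegral_ge0 => x /fg; rewrite mulN1r subr_ge0.
Qed.

End divergence.

Section is_derive_pointwise.
Context {R : realType} {V : normedModType R}.
Implicit Types (f g : V -> R) (x v : V) (a b k : R).

Lemma is_derive_add f g x v a b : is_derive x v f a -> is_derive x v g b ->
  is_derive x v (fun y => f y + g y) (a + b).
Proof. by move=> fa gb; exact: is_deriveD. Qed.

Lemma is_derive_sub f g x v a b : is_derive x v f a -> is_derive x v g b ->
  is_derive x v (fun y => f y - g y) (a - b).
Proof. by move=> fa gb; exact: is_deriveB. Qed.

Lemma is_derive_mul f g x v a b : is_derive x v f a -> is_derive x v g b ->
  is_derive x v (fun y => f y * g y) (f x * b + g x * a).
Proof. by move=> fa gb; exact: is_deriveM. Qed.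

Lemma is_derive_scal k f x v a : is_derive x v f a ->
  is_derive x v (fun y => k * f y) (k * a).
Proof. by move=> fa; exact: is_deriveZ. Qed.

Lemma is_derive_sqr f x v a : is_derive x v f a ->
  is_derive x v (fun y => f y ^+ 2) (2 * f x * a).
Proof.
move=> fa; rewrite (_ : (fun _ => _) = fun y => f y * f y); last first.
  by apply/funext => y; rewrite expr2.
by have := is_derive_mul fa fa; rewrite (_ : 2 * f x * a = f x * a + f x * a)//; ring.
Qed.

Lemma is_derive_sumr m (F : 'I_m -> V -> R) (dF : 'I_m -> R) x v :
  (forall i, is_derive x v (F i) (dF i)) ->
  is_derive x v (fun y => \sum_(i < m) F i y) (\sum_(i < m) dF i).
Proof.
move=> dFi; rewrite (_ : (fun _ => _) = \sum_(i < m) F i); first exact: is_derive_sum.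
by apply/funext => y; rewrite fct_sumE.
Qed.

Lemma is_derive_unique f x v a b : is_derive x v f a -> is_derive x v f b -> a = b.
Proof. by move=> [_ <-] [_ <-]. Qed.

End is_derive_pointwise.

Section divergence_theorem.
Context {R : realType} {n : nat}.
Implicit Types (x : 'rV[R]_n) (r : R).

Lemma is_derive_coord x (v : 'rV[R]_n) j : is_derive x v (fun y : 'rV[R]_n => y 0 j) (v 0 j).
Proof.
apply: (@is_derive_comp_affine R R^o 'rV[R]_n id (fun y : 'rV[R]_n => y 0 j : R^o) v x (v 0 j)).
by move=> h; rewrite !mxE.
Qed.

Lemma is_derive_enorm_sqr x i :
  is_derive x (delta_mx 0 i : 'rV[R]_n) (fun y => enorm y ^+ 2) (2 * x 0 i).
Proof.
rewrite (_ : (fun _ => _) = fun y : 'rV[R]_n => \sum_(j < n) y 0 j ^+ 2); last first.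
  by apply/funext => y; rewrite enorm_sqr.
apply: is_derive_eq.
  by apply: is_derive_sumr => j; apply: is_derive_sqr; exact: is_derive_coord.
rewrite (bigD1 i)//= big1 ?addr0; first by rewrite !mxE !eqxx mulr1.
by move=> j ji; rewrite !mxE (negbTE ji) andbF mulr0.
Qed.

(* (s ^ 2 - |x| ^ 2) F_i vanishes on the sphere of radius s, so that
   s ^ 2 \int_{B_s} div F - \int_{B_s} |x| ^ 2 div F = 2 \int_{B_s} x.F for all s;
   the theorem is the derivative of this identity at s = r. *)
Lemma divergence_theorem (F dF : 'I_n -> 'rV[R]_n -> R) r : (0 < n)%N -> 0 < r ->
  (forall i, continuous (F i)) -> (forall i, continuous (dF i)) ->
  (forall i x, is_derive x (delta_mx 0 i : 'rV[R]_n) (F i) (dF i x)) ->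
  r * ball_integral (fun x => \sum_(i < n) dF i x) r =
  sphere_integral (fun x => \sum_(i < n) x 0 i * F i x) r.
Proof.
move=> n0 r0 cF cdF dFE.
set D := fun x => \sum_(i < n) dF i x; set N := fun x => \sum_(i < n) x 0 i * F i x.
have cD : continuous D by exact: continuous_sum.
have cN : continuous N.
  by apply: continuous_sum => i; apply: continuous_mul => //; exact: continuous_coord.
have ce : continuous (fun x : 'rV[R]_n => enorm x ^+ 2).
  by apply: continuous_expn; exact: continuous_enorm.
have ceD : continuous (fun x => enorm x ^+ 2 * D x) by exact: continuous_mul.
have key s : s ^+ 2 * ball_integral D s +
    (- 1 * ball_integral (fun x => enorm x ^+ 2 * D x) s + (- 2) * ball_integral N s) = 0.
  (* The [i]-th partial derivative of [(s ^+ 2 - enorm x ^+ 2) * F i x], for fixed [s]. *)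
  pose g i x := (s ^+ 2 - enorm x ^+ 2) * dF i x + F i x * (- (2 * x 0 i)).
  have cg i : continuous (g i).
    apply: continuous_add; apply: continuous_mul => //.
      by apply: continuous_sub => //; exact: cst_continuous.
    rewrite (_ : (fun _ => _) = fun x : 'rV[R]_n => - 2 * x 0 i); last first.
      by apply/funext => x; ring.
    by apply: continuous_scal; exact: continuous_coord.
  have g0 i : ball_integral (g i) s = 0.
    apply: (@ball_integral_derive_vanish _ _ i (fun x => (s ^+ 2 - enorm x ^+ 2) * F i x)) => //.
      move=> x; have h := is_derive_sub (is_derive_cst (s ^+ 2) x (delta_mx 0 i))
        (is_derive_enorm_sqr x i).
      by rewrite sub0r in h; exact: is_derive_mul h (dFE i x).
    by move=> x ->; rewrite subrr mul0r.
  have c1 := @continuous_scal R n (s ^+ 2) _ cD; have c2 := @continuous_scal R n (- 1) _ ceD.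
  have c3 := @continuous_scal R n (- 2) _ cN; have c4 := continuous_add c2 c3.
  rewrite -!ball_integralZ// -(ball_integralD _ c2 c3) -(ball_integralD _ c1 c4).
  transitivity (ball_integral (fun x => \sum_(i < n) g i x) s).
    apply: eq_Rintegral => x _; rewrite /g /D /N !mulr_sumr -!big_split/=.
    by apply: eq_bigr => i _; ring.
  by rewrite ball_integral_sum// big1.
have dI (f : 'rV[R]_n -> R) : continuous f -> is_derive r 1 (ball_integral f) (sphere_integral f r).
  by move=> cf; exact (is_derive_ball_integral n0 r0 cf).
have d0 : is_derive r 1 (fun s : R => s ^+ 2 * ball_integral D s +
    (- 1 * ball_integral (fun x => enorm x ^+ 2 * D x) s + (- 2) * ball_integral N s)) 0.
  under eq_fun do rewrite key; exact: is_derive_cst.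
(* The product rule leaves two sphere integrals of [D], weighted by [r ^+ 2] and by
   [- enorm x ^+ 2]. They cancel on the sphere of radius [r], and the theorem remains, doubled. *)
have := is_derive_unique d0 (is_derive_add
  (is_derive_mul (is_derive_sqr (is_derive_id r 1)) (dI _ cD))
  (is_derive_add (is_derive_scal (-1) (dI _ ceD)) (is_derive_scal (-2) (dI _ cN)))).
rewrite (_ : sphere_integral (fun x => enorm x ^+ 2 * D x) r =
    r ^+ 2 * sphere_integral D r); last first.
  by rewrite -sphere_integralZ//; apply: sphere_integral_ext => x ->.
move=> /= H; lra.
Qed.

Lemma divergence_on_ball (F dF : 'I_n -> 'rV[R]_n -> R) (D f : 'rV[R]_n -> R) r :
  (0 < n)%N -> 0 < r ->
  (forall i, continuous (F i)) -> (forall i, continuous (dF i)) ->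
  (forall i x, is_derive x (delta_mx 0 i : 'rV[R]_n) (F i) (dF i x)) ->
  (forall x, \sum_(i < n) dF i x = D x) ->
  (forall x, enorm x = r -> \sum_(i < n) x 0 i * F i x = f x) ->
  r * ball_integral D r = sphere_integral f r.
Proof.
move=> n0 r0 cF cdF dFE dFD Ff.
rewrite -(sphere_integral_ext Ff) -(divergence_theorem n0 r0 cF cdF dFE).
by congr (_ * _); apply: eq_Rintegral => x _.
Qed.

End divergence_theorem.

(** * Mixed partial derivatives, gradients and powers *)

Section line_calculus.
Context {R : realType} {V : normedModType R}.
Implicit Types (f a b : V -> R) (x y v w : V).

Lemma is_derive_line f y v (s d : R) : is_derive (s *: v + y) v f d ->
  is_derive s 1 (fun t => f (t *: v + y)) d.
Proof.
move=> fd; apply: (@is_derive_comp_affine R V R^o f (fun t => t *: v + y) 1 s v) => h.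
by rewrite scalerDl addrA [h *: 1]mulr1.
Qed.

Lemma is_derive_of_line f x v (d : R) :
  is_derive (0 : R) 1 (fun t => f (t *: v + x)) d -> is_derive x v f d.
Proof.
move=> [df fd].
have E : (fun h => h^-1 *: ((f \o shift x) (h *: v) - f x)) =
    (fun h => h^-1 *: (((fun t => f (t *: v + x)) \o shift (0 : R)) (h *: 1) - f (0 *: v + x))).
  by apply/funext => h /=; rewrite addr0 scale0r add0r [h *: 1]mulr1.
by split; rewrite /derivable /derive E.
Qed.

Lemma MVT_line f a y v (s : R) : (forall x, is_derive x v f (a x)) ->
  exists2 t, `|t| <= `|s| & f (s *: v + y) - f y = s * a (t *: v + y).
Proof.
move=> fa.
have dl (s0 : R) : is_derive s0 1 (fun t => f (t *: v + y)) (a (s0 *: v + y)).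
  exact: is_derive_line.
have cl : continuous (fun t : R => f (t *: v + y)).
  by move=> t; apply/differentiable_continuous/derivable1_diffP; case: (dl t).
have f0 : f y = f (0 *: v + y) by rewrite scale0r add0r.
have [s0|s0] := leP 0 s.
  have [t] := @MVT_segment R _ (fun t => a (t *: v + y)) 0 s s0
    (fun t _ => dl t) (continuous_subspaceT cl).
  rewrite in_itv/= => /andP[t0 ts] E; exists t; first by rewrite !ger0_norm.
  by rewrite f0 E subr0 mulrC.
have [t] := @MVT_segment R _ (fun t => a (t *: v + y)) s 0 (ltW s0)
  (fun t _ => dl t) (continuous_subspaceT cl).
rewrite in_itv/= => /andP[ts t0] E; exists t.
  by rewrite !ler0_norm ?lerN2// ltW.
by rewrite f0 -opprB E sub0r mulrN opprK mulrC.
Qed.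

(** The mean value theorem twice: along [v] for the increment of [f] by [h *: w], then along [w] for
    [a]. *)
Lemma second_difference f a b x v w (h : R) :
  (forall y, is_derive y v f (a y)) -> (forall y, is_derive y w a (b y)) ->
  exists s t, [/\ `|s| <= `|h|, `|t| <= `|h| &
    f (h *: w + (h *: v + x)) - f (h *: v + x) - (f (h *: w + x) - f x) =
    h * (h * b (t *: w + (s *: v + x)))].
Proof.
move=> fa ab.
have da y : is_derive y v (fun y => f (h *: w + y) - f y) (a (h *: w + y) - a y).
  apply: is_derive_sub => //.
  by apply: (@is_derive_comp_affine R V V f (fun y => h *: w + y) v y v) => k; rewrite addrCA.
have [s sh ->] := MVT_line x h da.
have [t th ->] := MVT_line (s *: v + x) h ab.
by exists s, t.
Qed.

Lemma continuous_two_scale b x v w (e : R) : continuous b -> 0 < e ->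
  exists2 d : R, 0 < d & forall s t : R, `|s| < d -> `|t| < d ->
    `|b (t *: w + (s *: v + x)) - b x| < e.
Proof.
move=> cb e0.
have cF : continuous (fun p : R * R => b (p.1 *: w + (p.2 *: v + x)) - b x).
  apply: continuous_sub; last exact: cst_continuous.
  move=> p; apply: (@continuous_comp _ _ _
    (fun p : R * R => p.1 *: w + (p.2 *: v + x)) b); last exact: cb.
  apply: cvgD; first by apply: cvgZr_tmp; exact: cvg_fst.
  by apply: cvgD; [apply: cvgZr_tmp; exact: cvg_snd|exact: cvg_cst].
have := cF (0, 0); rewrite /continuous_at/= !scale0r !add0r subrr => /cvgr0_norm_lt /(_ _ e0).
move=> /nbhs_ballP[d /= d0 dP]; exists d => // s t sd td.
apply: (dP (t, s)); split; rewrite /ball/= sub0r normrN//.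
Qed.

(** Schwarz's theorem: the second difference is symmetric in [v] and [w], so [h ^ 2] times a value
    of [b] near [x] equals [h ^ 2] times a value of [c] near [x]. *)
Lemma derive_comm f a a' b c x v w : continuous b -> continuous c ->
  (forall y, is_derive y v f (a y)) -> (forall y, is_derive y w a (b y)) ->
  (forall y, is_derive y w f (a' y)) -> (forall y, is_derive y v a' (c y)) ->
  b x = c x.
Proof.
move=> cb cc fa ab fa' a'c; apply/eqP; rewrite -subr_eq0 -normr_le0.
apply/ler_addgt0Pr => e e0; rewrite add0r.
have e20 : 0 < e / 2 by rewrite divr_gt0.
have [d1 d10 d1P] := continuous_two_scale x v w cb e20.
have [d2 d20 d2P] := continuous_two_scale x w v cc e20.
pose h := Num.min d1 d2 / 2.
have h0 : 0 < h by rewrite divr_gt0// lt_min d10.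
have hd : h < Num.min d1 d2 by rewrite /h ltr_pdivrMr// ltr_pMr ?ltr1n// lt_min d10.
have [s [t [sh th E]]] := second_difference x h fa ab.
have [s' [t' [sh' th' E']]] := second_difference x h fa' a'c.
move: hd; rewrite lt_min => /andP[hd1 hd2].
rewrite !(gtr0_norm h0) in sh th sh' th'.
have P1 := d1P s t (le_lt_trans sh hd1) (le_lt_trans th hd1).
have P2 := d2P s' t' (le_lt_trans sh' hd2) (le_lt_trans th' hd2).
have bc : b (t *: w + (s *: v + x)) = c (t' *: v + (s' *: w + x)).
  apply: (mulfI (lt0r_neq0 h0)); apply: (mulfI (lt0r_neq0 h0)).
  by rewrite -E -E' [h *: v + (_ + x)]addrCA; ring.
rewrite ltr_norml in P1; rewrite ltr_norml in P2; rewrite ler_norml.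
move: P1 P2; rewrite bc; set z := c (_ + _) => /andP[? ?] /andP[? ?].
by apply/andP; split; lra.
Qed.

Lemma is_derive_comp_real (phi : R -> R) f x v (d e : R) :
  is_derive (f x) 1 phi d -> is_derive x v f e ->
  is_derive x v (fun y => phi (f y)) (d * e).
Proof.
move=> dphi df.
have l0 : is_derive (0 : R) 1 (fun t => f (t *: v + x)) e.
  by apply: (@is_derive_line f x v 0 e); rewrite scale0r add0r.
have dphi0 : is_derive (f (0 *: v + x)) 1 phi d by rewrite scale0r add0r.
exact: (is_derive_of_line (is_derive1_comp dphi0 l0)).
Qed.

Lemma is_derive_powR f x v (p e : R) : 0 < f x -> is_derive x v f e ->
  is_derive x v (fun y => f y `^ p) (p * f x `^ (p - 1) * e).
Proof.
move=> fx0 fe.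
exact: (is_derive_comp_real (is_derive1_powR p fx0) fe).
Qed.

End line_calculus.

Lemma continuous_powR (R : realType) (T : topologicalType) (f : T -> R) (p : R) :
  continuous f -> (forall x, 0 < f x) -> continuous (fun x => f x `^ p).
Proof.
move=> cf f0 x; apply: (@continuous_comp _ _ _ f (fun t : R => t `^ p)); first exact: cf.
apply/differentiable_continuous/derivable1_diffP.
by have [] := is_derive1_powR p (f0 x).
Qed.

Section gradient.
Context {R : realType} {n : nat}.
Implicit Types (f : 'rV[R]_n -> R) (a : 'I_n -> 'rV[R]_n -> R) (x v : 'rV[R]_n).

(** The mean value theorem along [w], started from the moving point [h *: v + x], gives a value of
    [a] that tends to [a x]. Adding one coordinate direction at a time yields the gradient formula
    from continuous partial derivatives. *)
Lemma is_derive_add_axis f (a : 'rV[R]_n -> R) x v w (c d : R) : continuous a ->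
  (forall y, is_derive y w f (a y)) -> is_derive x v f d ->
  is_derive x (c *: w + v) f (c * a x + d).
Proof.
move=> ca fa fd.
have h1 : h^-1 *: ((f \o shift x) (h *: v) - f x) @[h --> (0 : R)^'] --> d.
  by have [/cvg_ex[l dl] <-] := fd; rewrite /derive (cvg_lim _ dl).
pose psi h := h^-1 *: (f (h *: (c *: w + v) + x) - f (h *: v + x)).
have h2 : psi h @[h --> (0 : R)^'] --> c * a x.
  apply/cvgrPdist_lt => e e0.
  (* The factor [|c| + 1] serves twice: it absorbs the coefficient [c] in front of [a], and in [hd1]
     it bounds both [|h|] and [|h * c|]. *)
  have e10 : 0 < e / (`|c| + 1) by rewrite divr_gt0// ltr_wpDl.
  have [d1 d10 d1P] := continuous_two_scale x v w ca e10.
  near=> h.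
  have hn0 : h != 0 by near: h; exact: nbhs_dnbhs_neq.
  have hd1 : `|h| * (`|c| + 1) < d1.
    rewrite -ltr_pdivlMr ?ltr_wpDl//; near: h; apply: dnbhs0_lt.
    by rewrite divr_gt0// ltr_wpDl.
  have [t th E] := MVT_line (h *: v + x) (h * c) fa.
  rewrite /psi [h *: (_ + _)]scalerDr scalerA -addrA E.
  rewrite [_ *: _](_ : _ = c * a (t *: w + (h *: v + x))); last first.
    by rewrite /GRing.scale/= -mulrA mulKf.
  rewrite -mulrBr normrM distrC.
  have hd2 : `|h| < d1.
    by apply: le_lt_trans hd1; rewrite ler_peMr// lerDr.
  have td : `|t| < d1.
    by apply: (le_lt_trans th); apply: le_lt_trans hd1; rewrite normrM ler_wpM2l// lerDl.
  have := d1P h t hd2 td.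
  rewrite ltr_pdivlMr ?ltr_wpDl// mulrC; apply: le_lt_trans.
  by rewrite ler_wpM2r// lerDl.
have h3 : h^-1 *: ((f \o shift x) (h *: (c *: w + v)) - f x) @[h --> (0 : R)^'] --> c * a x + d.
  rewrite (_ : (fun _ => _) = psi \+ fun h => h^-1 *: ((f \o shift x) (h *: v) - f x)).
    exact: cvgD.
  by apply/funext => h; rewrite /psi/= -scalerDr addrA subrK.
by split; [apply/cvg_ex; exists (c * a x + d)|exact: cvg_lim].
Unshelve. all: by end_near. Qed.

Lemma is_derive_gradient f a x v : (forall i, continuous (a i)) ->
  (forall i y, is_derive y (delta_mx 0 i : 'rV[R]_n) f (a i y)) ->
  is_derive x v f (\sum_(i < n) v 0 i * a i x).
Proof.
move=> ca fa; rewrite [v in is_derive _ v](row_sum_delta v).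
elim: (index_enum _) => [|i s IH]; first by rewrite !big_nil; exact: is_derive0.
by rewrite !big_cons; exact: is_derive_add_axis.
Qed.

End gradient.

(** * Pohozaev's identity *)

(** The function [f + c * ln] has a nonpositive derivative. *)
Lemma log_decrease (R : realType) (f df : R -> R) (r0 c : R) : 0 < r0 ->
  (forall r, r0 <= r -> is_derive r 1 f (df r)) ->
  (forall r, r0 <= r -> r * df r <= - c) ->
  forall r, r0 <= r -> f r <= f r0 - c * (ln r - ln r0).
Proof.
move=> r00 fdf dfc r r0r.
pose g (s : R) := f s + c * ln s; pose dg (s : R) := df s + c * s^-1.
have dgE s : r0 <= s -> is_derive s 1 g (dg s).
  move=> r0s; apply: is_derive_add; first exact: fdf.
  by apply: is_derive_scal; apply: is_derive1_ln; exact: lt_le_trans r0s.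
have cg : {within `[r0, r], continuous g}.
  apply: derivable_within_continuous => s; rewrite in_itv/= => /andP[r0s _].
  by have [] := dgE s r0s.
have [s|s] := @MVT_segment R g dg r0 r r0r _ cg.
  by rewrite in_itv/= => /andP[r0s _]; apply: dgE; exact: ltW.
rewrite in_itv/= => /andP[r0s _] E.
have s0 : 0 < s by exact: lt_le_trans r0s.
have dgs : dg s <= 0.
  rewrite -(pmulr_rle0 _ s0) /dg mulrDr mulrCA divff ?gt_eqF// mulr1.
  by rewrite -(addNr c) lerD2r; exact: dfc.
have : g r - g r0 <= 0 by rewrite E mulr_le0_ge0// subr_ge0.
rewrite /g; set a := ln r; set b := ln r0; lra.
Qed.

(* In the variable ln r, the hypotheses say that m' = Q and m'' <= - c. *)
Lemma no_log_concave (R : realType) (m Q dQ : R -> R) (r0 c : R) : 0 < r0 -> 0 < c ->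
  (forall r, r0 <= r -> is_derive r 1 m (Q r / r)) ->
  (forall r, r0 <= r -> is_derive r 1 Q (dQ r)) ->
  (forall r, r0 <= r -> r * dQ r <= - c) ->
  (forall r, r0 <= r -> 0 <= m r) -> False.
Proof.
move=> r00 c0 dm dQE dQc m0.
have QE := log_decrease r00 dQE dQc.
(* [a] is the increase of [ln r] during which [Q], decreasing at rate at least [c], loses
   [|Q r0| + 1]; hence [Q <= -1] from [r1] on. *)
pose a := (`|Q r0| + 1) / c; pose r1 := r0 * expR a.
have ca : c * a = `|Q r0| + 1 by rewrite mulrC divfK// gt_eqF.
have a0 : 0 <= a by rewrite divr_ge0 ?addr_ge0// ltW.
have r01 : r0 <= r1 by rewrite ler_peMr ?(ltW r00)// -expR0 ler_expR.
have r10 : 0 < r1 by exact: lt_le_trans r01.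
have Q1 r : r1 <= r -> Q r <= - 1.
  move=> r1r; apply: (le_trans (QE r (le_trans r01 r1r))).
  have : ln r1 <= ln r by rewrite ler_ln ?posrE// (lt_le_trans r10).
  rewrite /r1 lnM ?posrE ?expR_gt0// expRK -(ler_pM2l c0) mulrDr ca.
  have := ler_norm (Q r0); rewrite mulrBr; move: (c * ln r) (ln r0) => z w; nra.
have mE : forall r, r1 <= r -> m r <= m r1 - 1 * (ln r - ln r1).
  apply: (log_decrease r10 (df := fun r => Q r / r)) => r r1r.
    by apply: dm; exact: le_trans r1r.
  by rewrite mulrCA divff ?mulr1 ?Q1// gt_eqF// (lt_le_trans r10).
(* Beyond [r1], [m] decreases at rate at least 1 in [ln r], so at this radius it is at most [-1]. *)
have r12 : r1 <= r1 * expR (m r1 + 1).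
  by rewrite ler_peMr ?(ltW r10)// -expR0 ler_expR addr_ge0// m0.
have := mE _ r12; rewrite lnM ?posrE ?expR_gt0// expRK.
have := m0 _ (le_trans r01 r12); lra.
Qed.

Section pohozaev_identity.
Context {R : realType} {n : nat} (K u : 'rV[R]_n -> R).
Context (hn : (3 <= n)%N) (hK : smooth K) (hu : smooth u)
  (hupos : forall x, 0 < u x)
  (heq : forall x, laplacian u x + K x * u x `^ ((n%:R + 2) / (n%:R - 2)) = 0).

Let N : R := n%:R.
Let p : R := (N + 2) / (N - 2).
Let q : R := 2 * N / (N - 2).
Let W x := u x `^ q.
Let G x := \sum_(i < n) partial u i x ^+ 2.
Let E x := dot_grad u x.
Let KW x := K x * W x.

Let n0 : (0 < n)%N. Proof. exact: leq_trans hn. Qed.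
Let N2 : 0 < N - 2.
Proof. by rewrite subr_gt0 /N ltr_nat. Qed.
Let N0 : 0 < N. Proof. by rewrite /N ltr0n. Qed.

Let uW x : u x * u x `^ p = W x.
Proof.
rewrite /W (_ : p = q - 1); last by rewrite /p /q; field; rewrite gt_eqF.
by rewrite mulr_powRB1 ?ltW// /q divr_gt0// mulr_gt0.
Qed.

Let cu : continuous u. Proof. by have [] := hu [::]. Qed.
Let cU i : continuous (partial u i). Proof. by have [] := hu [:: i]. Qed.
Let cUU i j : continuous (partial (partial u i) j).
Proof. by have [] := hu [:: i; j]. Qed.
Let cK : continuous K. Proof. by have [] := hK [::]. Qed.
Let cdK i : continuous (partial K i). Proof. by have [] := hK [:: i]. Qed.

Let e i : 'rV[R]_n := delta_mx 0 i.
Let dcoord x i j : is_derive x (e i) (fun y : 'rV[R]_n => y 0 j) (i == j)%:R.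
Proof. by have := is_derive_coord x (e i) j; rewrite mxE eqxx eq_sym. Qed.
Let du x i : is_derive x (e i) u (partial u i x).
Proof. by have [_ /(_ i x)] := hu [::]; exact: derivableP. Qed.
Let dU x i j : is_derive x (e j) (partial u i) (partial (partial u i) j x).
Proof. by have [_ /(_ j x)] := hu [:: i]; exact: derivableP. Qed.
Let dK x i : is_derive x (e i) K (partial K i x).
Proof. by have [_ /(_ i x)] := hK [::]; exact: derivableP. Qed.

Let UUC i j x : partial (partial u i) j x = partial (partial u j) i x.
Proof.
apply: (@derive_comm R _ u (partial u i) (partial u j) _ _ x (e i) (e j)).
- exact: cUU.
- exact: cUU.
- by move=> y; exact: du.
- by move=> y; exact: dU.
- by move=> y; exact: du.
- by move=> y; exact: dU.
Qed.

Let dW x i : is_derive x (e i) W (q * u x `^ p * partial u i x).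
Proof.
rewrite (_ : p = q - 1); last by rewrite /p /q; field; rewrite gt_eqF.
exact: is_derive_powR.
Qed.

Let cW : continuous W.
Proof. exact: continuous_powR. Qed.

Let cx i : continuous (fun x : 'rV[R]_n => x 0 i).
Proof. exact: continuous_coord. Qed.
Let cG : continuous G.
Proof. by apply: continuous_sum => i; exact: continuous_expn. Qed.
Let cE : continuous E.
Proof. by apply: continuous_sum => i; exact: continuous_mul. Qed.
Let cKW : continuous KW. Proof. exact: continuous_mul. Qed.
Let cuu : continuous (fun x => u x ^+ 2). Proof. exact: continuous_expn. Qed.
Let cuE : continuous (fun x => u x * E x). Proof. exact: continuous_mul. Qed.
Let cEE : continuous (fun x => E x ^+ 2). Proof. exact: continuous_expn. Qed.

(* The divergence of u ^ 2 x. *)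
Definition mass_source x := N * u x ^+ 2 + 2 * (u x * E x).
Let cM : continuous mass_source.
Proof. by apply: continuous_add; exact: continuous_scal. Qed.
(* The divergence of u grad u, by the equation. *)
Definition energy_density x := G x - KW x.
Let cD : continuous energy_density. Proof. exact: continuous_sub. Qed.

Let S := @sphere_integral R n.


Let cprod (f g : 'rV[R]_n -> R) : continuous f -> continuous g -> continuous (fun x => f x * g x).
Proof. exact: continuous_mul. Qed.
Let cplus (f g : 'rV[R]_n -> R) : continuous f -> continuous g -> continuous (fun x => f x + g x).
Proof. exact: continuous_add. Qed.
Let ccst (k : R) : continuous (fun _ : 'rV[R]_n => k).
Proof. exact: cst_continuous. Qed.
Let cup : continuous (fun x => u x `^ p).
Proof. exact: continuous_powR. Qed.

Let lapE x : \sum_(i < n) partial (partial u i) i x = - (K x * u x `^ p).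
Proof. by apply/eqP; rewrite -addr_eq0; apply/eqP; exact: heq. Qed.

Lemma sphere_mass r : 0 < r ->
  r * ball_integral mass_source r = r ^+ 2 * S (fun x => u x ^+ 2) r.
Proof.
move=> r0; rewrite /S -sphere_integralZ//.
apply: (divergence_on_ball (F := fun i x => u x ^+ 2 * x 0 i)
  (dF := fun i x => u x ^+ 2 * (i == i)%:R + x 0 i * (2 * u x * partial u i x))) => //.
- by move=> i; exact: cprod.
- move=> i; apply: cplus; apply: cprod => //; apply: cprod => //.
  exact: cprod.
- by move=> i x; exact: is_derive_mul (is_derive_sqr (du x i)) (dcoord x i i).
- move=> x; rewrite big_split/= /mass_source; congr (_ + _).
    under eq_bigr do rewrite eqxx mulr1.
    by rewrite sumr_const card_ord mulr_natl.
  by rewrite /E /dot_grad !mulr_sumr; apply: eq_bigr => i _; ring.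
- move=> x xr; rewrite -xr enorm_sqr mulr_suml.
  by apply: eq_bigr => i _; ring.
Qed.

Lemma sphere_energy r : 0 < r ->
  r * ball_integral energy_density r = S (fun x => u x * E x) r.
Proof.
move=> r0; apply: (divergence_on_ball (F := fun i x => u x * partial u i x)
  (dF := fun i x => u x * partial (partial u i) i x + partial u i x * partial u i x)) => //.
- by move=> i; exact: cprod.
- by move=> i; apply: cplus; exact: cprod.
- by move=> i x; exact: is_derive_mul (du x i) (dU x i i).
- move=> x; rewrite big_split/= -mulr_sumr lapE /energy_density addrC; congr (_ + _).
  by rewrite mulrN /KW -uW; congr (- _); ring.
- by move=> x _; rewrite /E /dot_grad mulr_sumr; apply: eq_bigr => i _; ring.
Qed.

(** The coefficients are forced. [-1/2] cancels the second derivatives of [u] produced by (x.grad u)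
    grad u, and [(N - 2) / (2 * N) = q^-1] cancels the term [E x] times the Laplacian of [u]. The
    weight [(N - 2) / 2] of u grad u then removes both [G] and [KW], since
    [1 - N / 2 + (N - 2) / 2 = 0]. *)
Let A x := - 2^-1 * G x + (N - 2) / (2 * N) * KW x.

(* The flux of the Pohozaev field (x.grad u) grad u + A x + (n - 2) / 2 u grad u. *)
Lemma sphere_pohozaev r : 0 < r ->
  r * pohozaev K u r = S (fun x => E x ^+ 2 + r ^+ 2 * A x + (N - 2) / 2 * (u x * E x)) r.
Proof.
move=> r0.
have cP : continuous (fun x => dot_grad K x * W x).
  apply: cprod => //; apply: continuous_sum => i; exact: cprod.
rewrite (_ : pohozaev K u r = (N - 2) / (2 * N) * ball_integral (fun x => dot_grad K x * W x) r)//.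
rewrite -ball_integralZ//.
pose dE (i : 'I_n) (x : 'rV[R]_n) := \sum_(j < n) (x 0 j * partial (partial u j) i x +
  partial u j x * (i == j)%:R).
pose dG (i : 'I_n) (x : 'rV[R]_n) := \sum_(j < n) 2 * partial u j x * partial (partial u j) i x.
pose dKW (i : 'I_n) (x : 'rV[R]_n) := K x * (q * u x `^ p * partial u i x) + W x * partial K i x.
pose dA (i : 'I_n) (x : 'rV[R]_n) := - 2^-1 * dG i x + (N - 2) / (2 * N) * dKW i x.
pose dF (i : 'I_n) (x : 'rV[R]_n) := E x * partial (partial u i) i x + partial u i x * dE i x +
  (A x * (i == i)%:R + x 0 i * dA i x) +
  (N - 2) / 2 * (u x * partial (partial u i) i x + partial u i x * partial u i x).
have cdE i : continuous (dE i).
  by apply: continuous_sum => j; apply: cplus; exact: cprod.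
have cdG i : continuous (dG i).
  by apply: continuous_sum => j; apply: cprod => //; exact: cprod.
have cdKW i : continuous (dKW i).
  apply: cplus; apply: cprod => //; apply: cprod => //; exact: cprod.
have cdA i : continuous (dA i) by apply: cplus; exact: cprod.
have cA : continuous A by apply: cplus; exact: cprod.
have dEE i x : is_derive x (e i) E (dE i x).
  by apply: is_derive_sumr => j; exact: is_derive_mul (dcoord x i j) (dU x j i).
have dGE i x : is_derive x (e i) G (dG i x).
  by apply: is_derive_sumr => j; exact: is_derive_sqr.
have dKWE i x : is_derive x (e i) KW (dKW i x).
  exact: is_derive_mul (dK x i) (dW x i).
have dAE i x : is_derive x (e i) A (dA i x).
  exact: is_derive_add (is_derive_scal _ (dGE i x)) (is_derive_scal _ (dKWE i x)).
apply: (divergence_on_ball (F := fun i x => E x * partial u i x + A x * x 0 i +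
  (N - 2) / 2 * (u x * partial u i x)) (dF := dF)) => //.
- move=> i; apply: cplus; last by apply: cprod => //; exact: cprod.
  by apply: cplus; exact: cprod.
- move=> i; apply: cplus; last by apply: cprod => //; apply: cplus; exact: cprod.
  by apply: cplus; apply: cplus; exact: cprod.
- move=> i x; apply: is_derive_add.
    apply: is_derive_add; first exact: is_derive_mul (dEE i x) (dU x i i).
    exact: is_derive_mul (dAE i x) (dcoord x i i).
  exact: is_derive_scal _ (is_derive_mul (du x i) (dU x i i)).
- move=> x.
  (* The Hessian term: it occurs with opposite signs in [sE], thanks to the symmetry of second
     derivatives, and in [sA]. *)
  pose T := \sum_(i < n) \sum_(j < n) x 0 i * (partial u j x * partial (partial u j) i x).
  have sE : \sum_(i < n) partial u i x * dE i x = T + G x.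
    rewrite /T exchange_big -big_split/=; apply: eq_bigr => i _.
    rewrite /dE big_split/= mulrDr; congr (_ + _).
      rewrite mulr_sumr; apply: eq_bigr => j _; rewrite (UUC j i); ring.
    rewrite (bigD1 i)//= eqxx big1 ?addr0; first by rewrite mulr1 expr2.
    by move=> j ji; rewrite eq_sym (negbTE ji) mulr0.
  (* The last term has coefficient 1 because [(N - 2) / (2 * N) * q = 1]; it cancels [E x] times the
     Laplacian of [u]. *)
  have sA : \sum_(i < n) x 0 i * dA i x =
      - T + (N - 2) / (2 * N) * (dot_grad K x * W x) + K x * u x `^ p * E x.
    rewrite /T -sumrN /dot_grad mulr_suml /E /dot_grad !mulr_sumr -!big_split/=.
    apply: eq_bigr => i _; rewrite /dA /dG /dKW.
    rewrite (_ : \sum_(j < n) 2 * partial u j x * partial (partial u j) i x =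
      2 * \sum_(j < n) partial u j x * partial (partial u j) i x); last first.
      by rewrite mulr_sumr; apply: eq_bigr => j _; ring.
    rewrite -mulr_sumr; set a := \sum_(j < n) _.
    by rewrite /q; field; rewrite !gt_eqF.
  rewrite /dF !big_split/= -!mulr_sumr !big_split/= -!mulr_sumr sE sA !lapE.
  rewrite (_ : \sum_(i < n) (i == i)%:R = N); last first.
    under eq_bigr do rewrite eqxx.
    by rewrite sumr_const card_ord.
  rewrite (_ : \sum_(i < n) partial u i x * partial u i x = G x); last first.
    by apply: eq_bigr => i _; rewrite expr2.
  rewrite /A /KW -uW; field.
  by rewrite gt_eqF.
- move=> x xr; rewrite -xr enorm_sqr mulr_suml.
  rewrite expr2 {1}/E {1}/dot_grad mulr_suml /E [in X in _ = _ + _ * (_ * X)]/dot_grad.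
  rewrite !mulr_sumr -!big_split/=.
  by apply: eq_bigr => i _; rewrite -/(dot_grad u x); ring.
Qed.

Let k : R := (N - 2) / 2.
Let Suu r := S (fun x => u x ^+ 2) r.
Let SuE r := S (fun x => u x * E x) r.
Let SEE r := S (fun x => E x ^+ 2) r.
Let SG r := S G r.
Let SKW r := S KW r.

Let SD (r : R) (r0 : 0 < r) (f g : 'rV[R]_n -> R) : continuous f -> continuous g ->
  S (fun x => f x + g x) r = S f r + S g r.
Proof. exact: sphere_integralD. Qed.

Let SZ (r : R) (r0 : 0 < r) (a : R) (f : 'rV[R]_n -> R) : continuous f ->
  S (fun x => a * f x) r = a * S f r.
Proof. exact: sphere_integralZ. Qed.

Definition radial_defect r := sphere_integral
  (fun x => r * (radial_derivative u x + (n%:R - 2) / 2 * (u x / r)) ^+ 2) r.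

Lemma radial_derivativeE x : radial_derivative u x = dot_grad u x / enorm x.
Proof.
rewrite /radial_derivative.
have [_ ->] := is_derive_gradient x ((enorm x)^-1 *: x) cU (fun i y => du y i).
by rewrite mulrC mulr_sumr; apply: eq_bigr => i _; rewrite mxE mulrA.
Qed.

(** On the sphere the radial derivative is [E x / r], so the integrand of the defect is
    [(E x + k * u x) ^+ 2 / r]. *)
Lemma radial_defectE r : 0 < r -> r * radial_defect r = SEE r + 2 * k * SuE r + k ^+ 2 * Suu r.
Proof.
move=> r0.
have c1 : continuous (fun x => 2 * k * (u x * E x)) by apply: cprod.
have c2 : continuous (fun x => k ^+ 2 * u x ^+ 2) by apply: cprod.
have c3 : continuous (fun x => E x ^+ 2 + 2 * k * (u x * E x)) by apply: cplus.
pose f x := E x ^+ 2 + 2 * k * (u x * E x) + k ^+ 2 * u x ^+ 2.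
have cf : continuous f by exact: cplus.
have <- : S f r = SEE r + 2 * k * SuE r + k ^+ 2 * Suu r by rewrite !SD// !SZ.
have -> : radial_defect r = sphere_integral (fun x => r^-1 * f x) r.
  apply: sphere_integral_ext => x xr; rewrite radial_derivativeE xr -/(E x) /f /k -/N.
  by field; rewrite gt_eqF.
by rewrite sphere_integralZ// mulrA divff ?mul1r// gt_eqF.
Qed.

Lemma pohozaev_sphereE r : 0 < r -> r * pohozaev K u r =
  SEE r + r ^+ 2 * (- 2^-1 * SG r + (N - 2) / (2 * N) * SKW r) + k * SuE r.
Proof.
move=> r0; rewrite sphere_pohozaev//.
have c1 : continuous (fun x => - 2^-1 * G x) by apply: cprod.
have c2 : continuous (fun x => (N - 2) / (2 * N) * KW x) by apply: cprod.
have cA : continuous A by apply: cplus.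
have c3 : continuous (fun x => r ^+ 2 * A x) by apply: cprod.
have c4 : continuous (fun x => E x ^+ 2 + r ^+ 2 * A x) by apply: cplus.
have c5 : continuous (fun x => (N - 2) / 2 * (u x * E x)) by apply: cprod.
by rewrite !SD// !SZ// /A SD// !SZ.
Qed.

Lemma pohozaev_defect_ge c : 0 < c ->
  (\forall r \near +oo, - 4 * pohozaev K u r + 4 * radial_defect r -
     4 / N * (r * sphere_integral (fun x => K x * u x `^ q) r) <= - c) -> False.
Proof.
move=> c0 [r0 [_ near_c]].
(* The bound holds only for [r > r0], strictly, and [r0] may be negative. *)
pose r1 := `|r0| + 1.
have r10 : 0 < r1 by rewrite ltr_wpDl.
have r1P r : r1 <= r -> 0 < r /\ r0 < r.
  move=> r1r; split; first exact: lt_le_trans r1r.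
  by apply: lt_le_trans r1r; rewrite /r1 (le_lt_trans (ler_norm _))// ltrDl.
(* [m r] equals [Suu r / r] and [Q r] equals [r] times the derivative of [m]; writing them through
   ball integrals makes both differentiable by [is_derive_ball_integral]. *)
pose m r := ball_integral mass_source r * r^-1 ^+ 2.
pose Q r := (N - 2) * m r + 2 * ball_integral energy_density r.
pose dQ r := (N - 2) * (Q r / r) + 2 * (SG r - SKW r).
have IM r : 0 < r -> ball_integral mass_source r = r * Suu r.
  by move=> r_gt0; apply: (mulfI (lt0r_neq0 r_gt0)); rewrite sphere_mass// mulrA -expr2.
have ID r : 0 < r -> ball_integral energy_density r = SuE r / r.
  move=> r_gt0; apply: (mulfI (lt0r_neq0 r_gt0)).
  by rewrite sphere_energy// mulrCA divff ?mulr1 ?gt_eqF.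
have SM r : 0 < r -> S mass_source r = N * Suu r + 2 * SuE r.
  by move=> r_gt0; rewrite SD ?SZ//; exact: cprod.
have SDe r : 0 < r -> S energy_density r = SG r - SKW r.
  move=> r_gt0; rewrite -mulN1r -SZ// -SD//; last exact: cprod.
  by apply: sphere_integral_ext => x _; rewrite mulN1r.
have QE r : 0 < r -> Q r = ((N - 2) * Suu r + 2 * SuE r) / r.
  by move=> r_gt0; rewrite /Q /m IM// ID//; field; rewrite gt_eqF.
have dm r : r1 <= r -> is_derive r 1 m (Q r / r).
  move=> /r1P[r_gt0 _].
  have di : is_derive r 1 (fun s : R => s^-1) (- r ^- 2).
    have := @is_deriveV R id r 1 1 (lt0r_neq0 r_gt0) (is_derive_id r 1).
    by rewrite [_ *: 1]mulr1.
  have := is_derive_mul (is_derive_ball_integral n0 r_gt0 cM) (is_derive_sqr di).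
  rewrite (_ : _ + _ = Q r / r)//.
  by rewrite -/(S _ r) SM// QE// IM//; field; rewrite gt_eqF.
have dQE r : r1 <= r -> is_derive r 1 Q (dQ r).
  move=> r1r; have [r_gt0 _] := r1P r r1r.
  have dD := is_derive_scal 2 (is_derive_ball_integral n0 r_gt0 cD).
  rewrite [sphere_integral _ r](SDe r r_gt0) in dD.
  exact: is_derive_add (is_derive_scal (N - 2) (dm r r1r)) dD.
apply: (@no_log_concave R m Q dQ r1 c r10 c0 dm dQE) => r /r1P[r_gt0 r0r].
  apply: le_trans (near_c r r0r); rewrite le_eqVlt; apply/orP; left; apply/eqP.
  (* Pohozaev's identity is solved for [SG]. The remaining terms in [SEE], [SuE] and [Suu] are those
     of [4 * radial_defect r], and [SKW] keeps the coefficient [2 * (N - 2) / N - 2 = - 4 / N], up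
     to the factor [r]. *)
  have rn0 : r != 0 by rewrite gt_eqF.
  have -> : pohozaev K u r = (SEE r + r ^+ 2 * (- 2^-1 * SG r +
      (N - 2) / (2 * N) * SKW r) + k * SuE r) / r.
    by rewrite -pohozaev_sphereE// mulrAC divff// mul1r.
  have -> : radial_defect r = (SEE r + 2 * k * SuE r + k ^+ 2 * Suu r) / r.
    by rewrite -radial_defectE// mulrAC divff// mul1r.
  rewrite (_ : sphere_integral _ r = SKW r)// /dQ QE//.
  move: (SEE r) (SG r) (SKW r) (SuE r) (Suu r) => *; rewrite /k; field.
  by rewrite rn0 gt_eqF.
rewrite /m IM//; apply: mulr_ge0; last exact: sqr_ge0.
apply: mulr_ge0; first exact: ltW.
by rewrite /Suu /S /sphere_integral; apply: Rintegral_ge0 => x _; exact: sqr_ge0.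
Qed.

End pohozaev_identity.

(** * Behaviour at infinity and conclusion *)

Lemma near_outside_compact (R : realType) n (C : set 'rV[R]_n) : compact C ->
  \forall r \near +oo, forall x, r <= enorm x -> ~ C x.
Proof.
move=> cC.
have cf : {within C, continuous (@enorm R n)}.
  by apply: continuous_subspaceT; exact: continuous_enorm.
have /compact_bounded[M [_ CM]] := continuous_compact cf cC.
near=> r; move=> x rx Cx.
have Mr : M < r - 1 by rewrite ltrBrDr; near: r; apply: nbhs_pinfty_gt; rewrite num_real.
have := CM (r - 1) Mr (enorm x) (ex_intro2 _ _ x Cx erefl).
by rewrite /= ger0_norm ?enorm_ge0// leNgt (lt_le_trans _ rx)// gtrBl.
Unshelve. all: by end_near. Qed.

Lemma sphere_integral_cst (R : realType) n (a r : R) : (0 < n)%N -> 0 < r ->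
  sphere_integral (fun _ : 'rV[R]_n => a) r = a * (n%:R * r ^+ n.-1 * ball_volume n 1).
Proof.
move=> n0 r0; rewrite sphere_integralE//; last exact: cst_continuous.
rewrite /ball_integral Rintegral_cst; last exact: measurable_eball.
rewrite -/(ball_volume n r) ball_volumeE//; last exact: ltW.
by rewrite -[in r ^+ n](prednK n0) exprS; field; rewrite gt_eqF.
Qed.

Theorem theoremD (R : realType) (n : nat) (hn : (3 <= n)%N)
    (K u : 'rV[R]_n -> R) (hK : smooth K)
    (hKbnd : exists (C : set 'rV[R]_n) (a b : R),
      [/\ compact C, 0 < a, 0 < b & forall x, ~ C x -> a <= K x <= b])
    (hu : smooth u) (hupos : forall x, 0 < u x)
    (heq : forall x,
      laplacian u x + K x * u x `^ ((n%:R + 2) / (n%:R - 2)) = 0)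
    (hlim : (\int[surface_measure n r]_(x in esphere n r)
        (r * (radial_derivative u x + (n%:R - 2) / 2 * (u x / r)) ^+ 2))
      @[r --> +oo] --> (0 : R))
    (hP : cvg (pohozaev K u r @[r --> +oo])) :
  pohozaev_number K u <= 0 /\
  (pohozaev_number K u = 0 ->
    limf_einf (fun x : 'rV[R]_n => (enorm x `^ ((n%:R - 2) / 2) * u x)%:E)
      (enorm_pinfty R n) = 0%E).
Proof.
have n0 : (0 < n)%N by exact: leq_trans hn.
have N2 : 0 < n%:R - 2 :> R by rewrite subr_gt0 ltr_nat.
have N0 : 0 < n%:R :> R by rewrite ltr0n.
set q : R := 2 * n%:R / (n%:R - 2).
have [C [a [b [cC a0 _ KC]]]] := hKbnd.
have outC := near_outside_compact cC.
have cu : continuous u by have [] := hu [::].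
have cKW : continuous (fun x => K x * u x `^ q).
  apply: continuous_mul; first by have [] := hK [::].
  exact: continuous_powR.
have Hlt e : 0 < e -> \forall r \near +oo, radial_defect u r < e.
  by move=> e0; apply: (cvgr_lt _ hlim).
have Pgt e : e < pohozaev_number K u -> \forall r \near +oo, e < pohozaev K u r.
  by move=> eP; apply: (cvgr_gt _ hP).
split.
  (* Eventually [pohozaev K u r > P / 2] and the defect is below [P / 4], so the first two terms
     stay below [-2 * P + P = - P]; the term with [K] only lowers the sum once the sphere lies
     outside [C]. *)
  rewrite leNgt; apply/negP => P0; set P := pohozaev_number K u in P0.
  apply: (pohozaev_defect_ge hn hK hu hupos heq (c := P) P0).
  near=> r.
  have r0 : 0 < r by near: r; apply: nbhs_pinfty_gt; rewrite num_real.
  have H : radial_defect u r < P / 4 by near: r; apply: Hlt; rewrite divr_gt0.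
  have Pr : P / 2 < pohozaev K u r.
    by near: r; apply: Pgt; rewrite -/P ltr_pdivrMr// ltr_pMr// ltr1n.
  have S0 : 0 <= 4 / n%:R * (r * sphere_integral (fun x => K x * u x `^ q) r).
    apply: mulr_ge0; first by rewrite divr_ge0// ltW.
    apply: mulr_ge0; first exact: ltW.
    apply: Rintegral_ge0 => x xr; apply: mulr_ge0; last exact: powR_ge0.
    have /KC/andP[aK _] : ~ C x.
      by move: x xr; near: r; apply: filterS outC => t
        tC x xt; apply: tC; rewrite (_ : enorm x = t).
    by apply: le_trans aK; exact: ltW.
  lra.
move=> P0; rewrite limf_einfE; apply/eqP; rewrite eq_le; apply/andP; split; last first.
  apply: (@le_trans _ _ (ereal_inf [set (enorm x `^ ((n%:R - 2) / 2) * u x)%:E | x in setT])).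
    apply: le_ereal_inf_tmp => _ [x _ <-].
    by rewrite lee_fin mulr_ge0 ?powR_ge0// ltW.
  apply: ereal_sup_ubound; exists setT => //; exact: filterT.
(* A positive lower limit, being a supremum of infima over sets of the filter, gives one such set
   with a positive infimum, hence a constant [d > 0] below [v] outside a ball. *)
rewrite leNgt; apply/negP => /ereal_sup_gt[_ [A FA <-]] infA.
have [d [d0 dA]] : exists d : R, 0 < d /\ forall x, A x -> d <= enorm x `^ ((n%:R - 2) / 2) * u x.
  have [d [d0 dinf]] : exists d : R, 0 < d /\
      (d%:E <= ereal_inf [set (enorm x `^ ((n%:R - 2) / 2) * u x)%:E | x in A])%E.
    move: infA; case: (ereal_inf _) => [d| |]//= d0; first by exists d.
    by exists 1; split => //; exact: leey.
  exists d; split => // x Ax; rewrite -lee_fin; apply: (le_trans dinf).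
  by apply: ereal_inf_lbound; exists x.
have FA' : \forall r \near (+oo_R)%R, forall x : 'rV[R]_n, r < enorm x -> A x := FA.
have [s sA] := filter_ex FA'.
have sr : \forall r \near +oo, s < r by apply: nbhs_pinfty_gt; rewrite num_real.
pose V := ball_volume n (1 : R).
have V0 : 0 < V := ball_volume1_gt0 n0.
have dq0 : 0 < d `^ q by rewrite powR_gt0.
(* Since [(n - 2) / 2 * q = n], the bound [d] on [v] gives [u x]^ q >= d [^ q * r ^- n] on the
   sphere, whose area is [n * r ^ (n - 1) * V]. With [K >= a] the powers of [r] cancel and [r] times
   the sphere integral is at least [k]. *)
pose k := a * d `^ q * (n%:R * V).
have k0 : 0 < k by rewrite !mulr_gt0.
(* The term with [K] is at most [-4 * (k / n)], while each of the other two is eventually below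
   [k / n], as [pohozaev K u r] and the defect both tend to 0. *)
apply: (pohozaev_defect_ge hn hK hu hupos heq (c := k / n%:R)); first exact: divr_gt0.
near=> r.
have r0 : 0 < r by near: r; apply: nbhs_pinfty_gt; rewrite num_real.
have H : radial_defect u r < k / n%:R / 4 by near: r; apply: Hlt; rewrite !divr_gt0.
have Pr : - (k / n%:R / 4) < pohozaev K u r.
  by near: r; apply: Pgt; rewrite P0 oppr_lt0 !divr_gt0.
have S0 : k <= r * sphere_integral (fun x => K x * u x `^ q) r.
  have Sl : sphere_integral (fun _ : 'rV[R]_n => a * (d `^ q * r ^- n)) r <=
      sphere_integral (fun x => K x * u x `^ q) r.
    have cc : continuous (fun _ : 'rV[R]_n => a * (d `^ q * r ^- n)) by exact: cst_continuous.
    apply: (sphere_integral_le n0 r0 cc cKW) => x xr.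
    have /KC/andP[aK _] : ~ C x.
      by move: x xr; near: r; apply: filterS outC => t
        tC x xt; apply: tC; rewrite (_ : enorm x = t).
    apply: ler_pM => //; [exact: ltW|by rewrite mulr_ge0 ?powR_ge0// invr_ge0 exprn_ge0// ltW|].
    have dx : d <= r `^ ((n%:R - 2) / 2) * u x.
      rewrite -xr; apply/dA/sA; rewrite xr; near: r; exact: sr.
    have : d `^ q <= (r `^ ((n%:R - 2) / 2) * u x) `^ q.
      apply: ge0_ler_powR => //; first by rewrite divr_ge0 ?mulr_ge0// ltW.
        by rewrite nnegrE ltW.
      by rewrite nnegrE mulr_ge0 ?powR_ge0// ltW.
    rewrite powRM ?powR_ge0//; last exact: ltW.
    rewrite -powRrM (_ : (n%:R - 2) / 2 * q = n%:R); last first.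
      by rewrite /q; field; rewrite gt_eqF.
    rewrite powR_mulrn; last exact: ltW.
    by rewrite ler_pdivrMr ?exprn_gt0// mulrC.
  apply: (@le_trans _ _ (r * sphere_integral (fun _ : 'rV[R]_n => a * (d `^ q * r ^- n)) r)).
    rewrite sphere_integral_cst// le_eqVlt; apply/orP; left; apply/eqP.
    rewrite /k -/V -[in r ^- n](prednK n0) exprS; field.
    by rewrite expf_neq0 ?gt_eqF.
  by rewrite ler_wpM2l// ltW.
have : 4 / n%:R * k <= 4 / n%:R * (r * sphere_integral (fun x => K x * u x `^ q) r).
  by rewrite ler_wpM2l// divr_ge0// ltW.
rewrite [4 / _ * k](_ : _ = 4 * (k / n%:R)); last by ring.
have y0 : 0 < k / n%:R by exact: divr_gt0.
by move: (k / n%:R) (4 / n%:R * (_ * _)) y0 H Pr => y z y0 H Pr yz; lra.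
Unshelve. all: by end_near. Qed.
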